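(* Identify each complete consistent extension of $T_{\mathrm{MSO(Fin)}}$ with the corresponding ultrafilter of $\mathrm{LT}$. Then for all $x,y,z\in S_0$: $\{\varphi+\psi:\varphi\in x,\ \psi\in y\}\subseteq z$ if and only if $z=x\oplus y$. In other words, the extended Stone dual of $(\mathrm{LT},+)$ is $(S_0,R)$ with $R(x,y,z)\iff z=x\oplus y$, i.e. it is $(S_0,\oplus)$.
   Context: Let $\mathcal{L}=\{\subseteq,\bot,\mathrm{At},\lhd\}$ be the first-order language with binary relation symbols $\subseteq,\lhd$, a constant $\bot$ and a unary relation symbol $\mathrm{At}$. Lowercase variables range over atoms; $X(x)$ abbreviates $x\subseteq X$. $T_{\mathrm{base}}$ states: $\subseteq$ is an atomic Boolean algebra order (one-element algebra allowed); $\lhd$ linearly orders the atoms; $\bot$ is least; $\mathrm{At}$ holds exactly of atoms; $\forall X\forall Y(X\lhd Y\leftrightarrow\exists x\exists y(X(x)\wedge Y(y)\wedge x\lhd y))$; and for every $\mathcal{L}$-formula $\eta(x;\bar Y)$, $\forall\bar Y\exists X\forall x(X(x)\leftrightarrow\eta(x;\bar Y))$. $T_{\mathrm{MSO(Fin)}}$ is $T_{\mathrm{base}}$ plus: the order on atoms is discrete with endpoints, and every $X\neq\bot$ contains a $\lhd$-least atom. For $M\models T_{\mathrm{base}}$ and $A\in M$, $M\upharpoonright A$ is the substructure with universe $\{X\in M: X\subseteq A\}$; for an $\mathcal{L}$-sentence $\varphi$, $\varphi^X$ denotes its relativisation, so that $M\models\varphi^A$ iff $M\upharpoonright A\models\varphi$.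 $\mathrm{LT}$ is the Lindenbaum–Tarski algebra of $T_{\mathrm{MSO(Fin)}}$ (sentences modulo $T_{\mathrm{MSO(Fin)}}$-provable equivalence), with binary operation $\varphi+\psi:=\exists X(\mathrm{dwcl}(X)\wedge\varphi^X\wedge\psi^{X^c})$, where $X^c$ is the Boolean complement and $\mathrm{dwcl}(X)$ is $\forall x\forall y(X(x)\wedge y\lhd x\rightarrow X(y))$ (downward closed). $S_0$ is the set of complete consistent extensions of $T_{\mathrm{MSO(Fin)}}$. For $M,N\models T_{\mathrm{base}}$, $M\oplus N$ has universe $|M|\times|N|$, $\subseteq$ componentwise, $\bot$ and $\mathrm{At}$ the bottom and atoms of the product Boolean algebra, and $(A,B)\lhd(C,D)$ iff ($A\neq\bot$ and $D\neq\bot$) or $M\models A\lhd C$ or $N\models B\lhd D$; for $x,y\in S_0$, $x\oplus y:=\mathrm{Th}(M\oplus N)$ for any $M\models x$, $N\models y$ (this is well defined and lies in $S_0$). The extended Stone dual of a Boolean algebra $L$ with a binary operation $\cdot$ preserving $\bot$ and finite joins in each argument is the space of ultrafilters of $L$ with ternary relation $R(x,y,z)\iff\{a\cdot b:a\in x,b\in y\}\subseteq z$. *)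

(* Defs.v *)
From HB Require Import structures.
From mathcomp Require Import all_boot all_order.
From mathcomp Require Import generic_quotient.
From mathcomp Require Import boolp classical_sets topology_structure.

Set Implicit Arguments.
Unset Strict Implicit.
Unset Printing Implicit Defensive.

Import Order.TTheory.
Local Open Scope classical_set_scope.

(* Variables are de Bruijn indices. *)
Inductive term := tvar of nat | tbot.

Inductive form :=
  | Fal
  | EqF of term & term
  | SubF of term & term
  | At of term
  | Lhd of term & term
  | Imp of form & form
  | All of form.

Definition Neg A := Imp A Fal.
Definition Tru := Neg Fal.
Definition And A B := Neg (Imp A (Neg B)).
Definition Or A B := Imp (Neg A) B.
Definition Iff A B := And (Imp A B) (Imp B A).
Definition Ex A := Neg (All (Neg A)).

Definition AllAt A := All (Imp (At (tvar 0)) A).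
Definition ExAt A := Ex (And (At (tvar 0)) A).

Definition subst_term (s : nat -> term) (t : term) : term :=
  if t is tvar i then s i else tbot.

Definition sh : term -> term := subst_term (fun i => tvar i.+1).

Definition up (s : nat -> term) (i : nat) : term :=
  if i is j.+1 then sh (s j) else tvar 0.

Fixpoint subst (s : nat -> term) (A : form) : form :=
  match A with
  | Fal => Fal
  | EqF t u => EqF (subst_term s t) (subst_term s u)
  | SubF t u => SubF (subst_term s t) (subst_term s u)
  | At t => At (subst_term s t)
  | Lhd t u => Lhd (subst_term s t) (subst_term s u)
  | Imp B C => Imp (subst s B) (subst s C)
  | All B => All (subst (up s) B)
  end.

Definition shift : form -> form := subst (fun i => tvar i.+1).

Definition inst (t : term) : form -> form :=
  subst (fun i => if i is j.+1 then tvar j else t).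

(* All free indices are smaller than n. *)
Definition tbnd (n : nat) (t : term) : bool := if t is tvar i then i < n else true.

Fixpoint bnd (n : nat) (A : form) : bool :=
  match A with
  | Fal => true
  | EqF t u | SubF t u | Lhd t u => tbnd n t && tbnd n u
  | At t => tbnd n t
  | Imp B C => bnd n B && bnd n C
  | All B => bnd n.+1 B
  end.

Definition closed_form (A : form) : bool := bnd 0 A.

HB.instance Definition _ := gen_eqMixin form.
HB.instance Definition _ := gen_choiceMixin form.

Record sentence := Sentence { sform :> form; sformP : closed_form sform }.

HB.instance Definition _ := [isSub for sform].
HB.instance Definition _ := [Choice of sentence by <:].

Definition theory := set sentence.

Declare Scope fo_scope.
Delimit Scope fo_scope with fo.
Bind Scope fo_scope with form.
Bind Scope fo_scope with term.

Notation "$ n" := (tvar n) (at level 1, n at level 0, format "$ n") : fo_scope.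
Notation "s == t" := (EqF s t) : fo_scope.
Notation "s <= t" := (SubF s t) : fo_scope.
Notation "s <| t" := (Lhd s t) (at level 70, no associativity) : fo_scope.
Notation "~ A" := (Neg A) : fo_scope.
Notation "A -> B" := (Imp A B) : fo_scope.
Notation "A /\ B" := (And A B) : fo_scope.
Notation "A \/ B" := (Or A B) : fo_scope.
Notation "A <-> B" := (Iff A B) : fo_scope.
Notation "'ALL' A" := (All A) (at level 200, A at level 200) : fo_scope.
Notation "'EX' A" := (Ex A) (at level 200, A at level 200) : fo_scope.
Notation "'ALLAT' A" := (AllAt A) (at level 200, A at level 200) : fo_scope.
Notation "'EXAT' A" := (ExAt A) (at level 200, A at level 200) : fo_scope.
Notation "'sent' A" := (@Sentence A%fo isT) (at level 10, A at level 9).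

Inductive prv : set form -> form -> Prop :=
  | prv_ax G A : G A -> prv G A
  | prv_impI G A B : prv (A |` G) B -> prv G (Imp A B)
  | prv_impE G A B : prv G (Imp A B) -> prv G A -> prv G B
  | prv_raa G A : prv (Neg A |` G) Fal -> prv G A
  | prv_allI G A : prv (shift @` G) A -> prv G (All A)
  | prv_allE G A t : prv G (All A) -> prv G (inst t A)
  | prv_eqI G t : prv G (EqF t t)
  | prv_eqE G A t u : prv G (EqF t u) -> prv G (inst t A) -> prv G (inst u A).

Definition proves (T : theory) (A : form) : Prop := prv (sform @` T) A.

Definition consistent (T : theory) : Prop := ~ proves T Fal.

Record structure := Structure {
  dom :> Type;
  ssub : dom -> dom -> Prop;
  sbot : dom;
  sAt : dom -> Prop;
  slhd : dom -> dom -> Prop }.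

Definition teval (M : structure) (e : nat -> M) (t : term) : M :=
  if t is tvar i then e i else sbot M.

Definition scons (M : Type) (a : M) (e : nat -> M) (i : nat) : M :=
  if i is j.+1 then e j else a.

Fixpoint sat (M : structure) (e : nat -> M) (A : form) : Prop :=
  match A with
  | Fal => False
  | EqF t u => teval e t = teval e u
  | SubF t u => ssub (teval e t) (teval e u)
  | At t => sAt (teval e t)
  | Lhd t u => slhd (teval e t) (teval e u)
  | Imp B C => sat e B -> sat e C
  | All B => forall a : M, sat (scons a e) B
  end.

Definition holds (M : structure) (A : form) : Prop := forall e : nat -> M, sat e A.

Definition models (M : structure) (T : theory) : Prop :=
  forall A : sentence, T A -> holds M A.

Definition Th (M : structure) : theory := [set A : sentence | holds M A].

Section Formulas.
Local Open Scope fo_scope.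

Definition f_meet (z x y : term) : form :=
  z <= x /\ z <= y /\ (ALL $0 <= sh x /\ $0 <= sh y -> $0 <= sh z).

Definition f_join (z x y : term) : form :=
  x <= z /\ y <= z /\ (ALL sh x <= $0 /\ sh y <= $0 -> sh z <= $0).

(* y is the complement of x: their meet is the bottom, their join the top. *)
Definition f_compl (y x : term) : form :=
  (ALL $0 <= sh x /\ $0 <= sh y -> $0 == tbot) /\
  (ALL sh x <= $0 /\ sh y <= $0 -> ALL $0 <= $1).

Definition f_atom (x : term) : form :=
  ~ x == tbot /\ (ALL $0 <= sh x -> $0 == tbot \/ $0 == sh x).

Definition f_dwcl (X : term) : form :=
  ALLAT ALLAT $1 <= sh (sh X) /\ $0 <| $1 -> $0 <= sh (sh X).

End Formulas.

Definition ba_axioms : seq sentence := [::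
  sent (ALL $0 <= $0);
  sent (ALL ALL $0 <= $1 /\ $1 <= $0 -> $0 == $1);
  sent (ALL ALL ALL $2 <= $1 /\ $1 <= $0 -> $2 <= $0);
  sent (ALL tbot <= $0);
  sent (EX ALL $0 <= $1);
  sent (ALL ALL EX f_meet $0 $2 $1);
  sent (ALL ALL EX f_join $0 $2 $1);
  (* for all x, y, z: if u = y join z, v = x meet u, p = x meet y, q = x meet z
     and w = p join q, then v = w; indices x = 7, y = 6, ..., w = 0 *)
  sent (ALL ALL ALL ALL ALL ALL ALL ALL
    f_join $4 $6 $5 /\ f_meet $3 $7 $4 /\ f_meet $2 $7 $6 /\ f_meet $1 $7 $5 /\
    f_join $0 $2 $1 -> $3 == $0);
  sent (ALL EX f_compl $0 $1);
  sent (ALL ~ $0 == tbot -> EX f_atom $0 /\ $0 <= $1)].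

(* The order on atoms is strict. *)
Definition order_axioms : seq sentence := [::
  sent (ALL At $0 <-> f_atom $0);
  sent (ALLAT ~ $0 <| $0);
  sent (ALLAT ALLAT ALLAT $2 <| $1 /\ $1 <| $0 -> $2 <| $0);
  sent (ALLAT ALLAT $1 <| $0 \/ $1 == $0 \/ $0 <| $1);
  sent (ALL ALL $1 <| $0 <-> EXAT EXAT $1 <= $3 /\ $0 <= $2 /\ $1 <| $0)].

(* eta has x as index 0 and its parameters as indices 1, ..., n; below the
   quantifiers over X and x, the index 1 is X and the parameters are moved. *)
Definition comp_form (n : nat) (eta : form) : form :=
  iter n All
    (EX ALLAT $0 <= $1 <->
       subst (fun i => if i is j.+1 then tvar j.+2 else tvar 0) eta)%fo.

Lemma tbnd_subst s n m t : (forall i, i < n -> tbnd m (s i)) ->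
  tbnd n t -> tbnd m (subst_term s t).
Proof. by case: t => //= i; apply. Qed.

Lemma bnd_subst s n m A : (forall i, i < n -> tbnd m (s i)) ->
  bnd n A -> bnd m (subst s A).
Proof.
elim: A n m s => [|t u|t u|t|t u|B IHB C IHC|B IHB] n m s hs //=.
1,2,4: by move=> /andP[/(tbnd_subst hs)-> /(tbnd_subst hs)->].
- exact: tbnd_subst.
- by move=> /andP[/(IHB _ _ _ hs)-> /(IHC _ _ _ hs)->].
- apply: IHB => -[|i] //= /hs.
  by case: (s i).
Qed.

Lemma bnd_iter_All k n A : bnd k (iter n All A) = bnd (n + k) A.
Proof. by elim: n k => //= n IH k; rewrite IH addnS. Qed.

Lemma comp_closed n eta : bnd n.+1 eta -> closed_form (comp_form n eta).
Proof.
move=> h; rewrite /closed_form bnd_iter_All addn0 /= !andbT.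
by rewrite (bnd_subst _ h) // => -[|i].
Qed.

Definition comprehension (n : nat) (eta : form) (h : bnd n.+1 eta) : sentence :=
  Sentence (comp_closed h).

Definition T_base : theory :=
  [set A | A \in ba_axioms ++ order_axioms] `|`
  [set A | exists n eta (h : bnd n.+1 eta), A = comprehension h].

(* The one-element algebra is allowed, hence the endpoints are only required
   when there is an atom. *)
Definition fin_axioms : seq sentence := [::
  sent (ALLAT (EXAT $1 <| $0) ->
    EXAT $1 <| $0 /\ ~ (EXAT $2 <| $0 /\ $0 <| $1));
  sent (ALLAT (EXAT $0 <| $1) ->
    EXAT $0 <| $1 /\ ~ (EXAT $1 <| $0 /\ $0 <| $2));
  sent ((EXAT Tru) -> EXAT ALLAT ~ $0 <| $1);
  sent ((EXAT Tru) -> EXAT ALLAT ~ $1 <| $0);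
  sent (ALL ~ $0 == tbot -> EXAT $0 <= $1 /\ (ALLAT $0 <= $2 -> ~ $0 <| $1))].

Definition T_fin : theory := T_base `|` [set A | A \in fin_axioms].

(* relat k A bounds the quantifiers of A by the variable that has index k
   outside A; for a sentence A, [relat 0 A] is the formula A^X with X = $0. *)
Fixpoint relat (k : nat) (A : form) : form :=
  match A with
  | Imp B C => Imp (relat k B) (relat k C)
  | All B => All (Imp (SubF (tvar 0) (tvar k.+1)) (relat k.+1 B))
  | _ => A
  end.

Definition restrict (M : structure) (A : M) (h : ssub (sbot M) A) : structure :=
  @Structure {X : M | ssub X A}
    (fun X Y => ssub (sval X) (sval Y)) (exist _ (sbot M) h)
    (fun X => sAt (sval X)) (fun X Y => slhd (sval X) (sval Y)).

Lemma eq_teval (M : structure) (e1 e2 : nat -> M) n t :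
  (forall i, i < n -> e1 i = e2 i) -> tbnd n t -> teval e1 t = teval e2 t.
Proof. by case: t => //= i; apply. Qed.

Lemma eq_sat (M : structure) (e1 e2 : nat -> M) n A :
  (forall i, i < n -> e1 i = e2 i) -> bnd n A -> sat e1 A <-> sat e2 A.
Proof.
elim: A n e1 e2 => [|t u|t u|t|t u|B IHB C IHC|B IHB] n e1 e2 he //=.
1,2,4: by move=> /andP[/(eq_teval he)-> /(eq_teval he)->].
- by move=> /(eq_teval he)->.
- by move=> /andP[/(IHB _ _ _ he) + /(IHC _ _ _ he)]; tauto.
- move=> hB.
  have E a : sat (scons a e1) B <-> sat (scons a e2) B.
    by apply: (IHB n.+1) => // -[|i] //= /he.
  by split=> H a; apply/E.
Qed.

Lemma sat_relat (M : structure) (A : M) (h : ssub (sbot M) A)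
    (phi : sentence) (e : nat -> M) :
  e 0 = A -> sat e (relat 0 phi) <-> holds (restrict h) phi.
Proof.
move=> e0.
suff H B k n (f : nat -> M) (g : nat -> restrict h) : f k = A -> n <= k ->
    (forall i, i < n -> f i = sval (g i)) -> bnd n B ->
    sat f (relat k B) <-> sat g B.
  case: phi => phi hphi; have E g := H phi 0 0 e g e0 isT (fun i => ltac:(by [])) hphi.
  by split=> [He g|Hg]; [apply/E|apply/(E (fun=> sbot (restrict h)))/Hg].
have tE m (f' : nat -> M) (g' : nat -> restrict h) t :
  (forall i, i < m -> f' i = sval (g' i)) -> tbnd m t ->
  teval f' t = sval (teval g' t) by move=> hfg; case: t => //= i /hfg.
elim: B k n f g => [|t u|t u|t|t u|B IHB C IHC|B IHB] k n f g fk nk hfg //=.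
- move=> /andP[/(tE _ _ _ _ hfg)-> /(tE _ _ _ _ hfg)->]; split=> [|->] //.
  exact: eq_sig_hprop (fun _ => @Prop_irrelevance _) _ _.
- by move=> /andP[/(tE _ _ _ _ hfg)-> /(tE _ _ _ _ hfg)->].
- by move=> /(tE _ _ _ _ hfg)->.
- by move=> /andP[/(tE _ _ _ _ hfg)-> /(tE _ _ _ _ hfg)->].
- by move=> /andP[/(IHB _ _ _ _ fk nk hfg) + /(IHC _ _ _ _ fk nk hfg)]; tauto.
- move=> hB; rewrite fk.
  have E a ha : sat (scons a f) (relat k.+1 B) <->
                sat (scons (exist _ a ha : restrict h) g) B.
    by apply: (IHB k.+1 n.+1) => // -[|i] //= /hfg.
  by split=> [H [a ha]|H a ha]; [apply/E/H|apply/(E a ha)].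
Qed.

Definition sumform (A B : form) : form :=
  (EX f_dwcl $0 /\ relat 0 A /\ (EX f_compl $0 $1 /\ relat 0 B))%fo.

Lemma tbnd_leq n m t : n <= m -> tbnd n t -> tbnd m t.
Proof. by case: t => //= i nm /leq_trans; apply. Qed.

Lemma bnd_relat k n m A : n <= k -> k < m -> n <= m -> bnd n A -> bnd m (relat k A).
Proof.
elim: A k n m => [|t u|t u|t|t u|B IHB C IHC|B IHB] k n m nk km nm //=.
1,2,4: by move=> /andP[/(tbnd_leq nm)-> /(tbnd_leq nm)->].
- exact: tbnd_leq.
- by move=> /andP[/(IHB _ _ _ nk km nm)-> /(IHC _ _ _ nk km nm)->].
- by move=> /(IHB k.+1 n.+1 m.+1)->; rewrite // ltnS km.
Qed.

Lemma sum_closed (A B : sentence) : closed_form (sumform A B).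
Proof.
case: A B => A hA [B hB]; rewrite /closed_form /=.
by rewrite !(bnd_relat _ _ _ hA) // !(bnd_relat _ _ _ hB).
Qed.

Definition splus (A B : sentence) : sentence := Sentence (sum_closed A B).

Lemma neg_closed (A : sentence) : closed_form (Neg A).
Proof. by case: A => A hA; rewrite /closed_form /= andbT. Qed.

Lemma and_closed (A B : sentence) : closed_form (And A B).
Proof. by case: A B => A hA [B hB]; apply/andP; split=> //=; apply/andP; split=> //; rewrite andbT. Qed.

Lemma or_closed (A B : sentence) : closed_form (Or A B).
Proof. by case: A B => A hA [B hB]; apply/andP; split=> //=; apply/andP; split. Qed.

Definition sneg (A : sentence) : sentence := Sentence (neg_closed A).
Definition sand (A B : sentence) : sentence := Sentence (and_closed A B).
Definition sor (A B : sentence) : sentence := Sentence (or_closed A B).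
Definition sfal : sentence := sent Fal.
Definition stru : sentence := sent Tru.

Lemma prv_weak G H A : G `<=` H -> prv G A -> prv H A.
Proof.
move=> + d; elim: d H => {G A} [G A GA|G A B _ IH|G A B _ IH1 _ IH2|G A _ IH
  |G A _ IH|G A t _ IH|G t|G A t u _ IH1 _ IH2] H GH.
- exact/prv_ax/GH.
- by apply/prv_impI/IH/setUS.
- exact: prv_impE (IH1 _ GH) (IH2 _ GH).
- by apply/prv_raa/IH/setUS.
- by apply/prv_allI/IH/image_subset.
- exact/prv_allE/IH.
- exact: prv_eqI.
- exact: prv_eqE (IH1 _ GH) (IH2 _ GH).
Qed.

Lemma prv_hyp G A : prv (A |` G) A. Proof. by apply: prv_ax; left. Qed.

Lemma prv_wk G A B : prv G B -> prv (A |` G) B.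
Proof. by apply: prv_weak => C; right. Qed.

Lemma prv_impP G A B : prv G (Imp A B) <-> prv (A |` G) B.
Proof.
split; last exact: prv_impI.
by move=> h; apply: prv_impE (prv_hyp _ _); apply: prv_wk.
Qed.

Lemma prv_cut G A B : prv G A -> prv (A |` G) B -> prv G B.
Proof. by move=> h /prv_impI /prv_impE; apply. Qed.

Lemma prv_exf G A : prv G Fal -> prv G A.
Proof. by move=> h; apply/prv_raa/prv_wk. Qed.

Lemma prv_andP G A B : prv G (And A B) <-> prv G A /\ prv G B.
Proof.
split=> [h|[hA hB]].
  split; apply: prv_raa.
    apply: prv_impE (prv_wk _ h) _; apply/prv_impI/prv_exf.
    exact: prv_impE (prv_wk _ (prv_hyp _ _)) (prv_hyp _ _).
  by apply: prv_impE (prv_wk _ h) _; apply/prv_impI/prv_wk/prv_hyp.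
apply: prv_impI; apply: prv_impE (prv_wk _ hB).
exact: prv_impE (prv_hyp _ _) (prv_wk _ hA).
Qed.

Lemma prv_orl G A B : prv G A -> prv G (Or A B).
Proof.
by move=> h; apply/prv_impI/prv_exf/(prv_impE (prv_hyp _ _))/prv_wk.
Qed.

Lemma prv_orr G A B : prv G B -> prv G (Or A B).
Proof. by move=> h; apply/prv_impI/prv_wk. Qed.

Lemma prv_orE G A B C :
  prv (Or A B |` G) C <-> prv (A |` G) C /\ prv (B |` G) C.
Proof.
split=> [/prv_impI h|[/prv_impI hA /prv_impI hB]].
  split; apply: prv_impE (prv_wk _ h) _.
    exact/prv_orl/prv_hyp.
  exact/prv_orr/prv_hyp.
apply: prv_raa; apply: prv_impE (prv_hyp _ _) _.
apply: prv_impE (prv_wk _ (prv_wk _ hB)) _.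
apply: prv_impE (prv_wk _ (prv_hyp _ _)) _; apply: prv_impI.
apply: prv_impE (prv_wk _ (prv_hyp _ _)) _.
by apply: prv_impE (prv_hyp _ _); do 3!apply: prv_wk.
Qed.

Lemma prv_em G A : prv G (Or A (Neg A)).
Proof. by apply/prv_impI/prv_hyp. Qed.

Definition entails (A B : sentence) : Prop := proves T_fin (Imp A B).

Lemma entails_refl A : entails A A.
Proof. exact/prv_impI/prv_hyp. Qed.

Lemma entails_trans B A C : entails A B -> entails B C -> entails A C.
Proof.
by move=> AB BC; apply/prv_impI/(prv_impE (prv_wk _ BC)); apply/prv_impP.
Qed.

Definition equiv (A B : sentence) : bool := `[< proves T_fin (Iff A B) >].

Lemma equivP A B : reflect (entails A B /\ entails B A) (equiv A B).
Proof. by apply: (iffP idP) => [/asboolP/prv_andP|h] //; apply/asboolP/prv_andP. Qed.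

Lemma equiv_refl : reflexive equiv.
Proof. by move=> A; apply/equivP; split; apply: entails_refl. Qed.

Lemma equiv_sym : symmetric equiv.
Proof. by move=> A B; apply/equivP/equivP => -[]. Qed.

Lemma equiv_trans : transitive equiv.
Proof.
move=> B A C /equivP[AB BA] /equivP[BC CB]; apply/equivP.
by split; [apply: entails_trans BC|apply: entails_trans BA].
Qed.

Canonical equiv_rel := EquivRel equiv equiv_refl equiv_sym equiv_trans.

Definition LT : Type := {eq_quot equiv_rel}%qT.
HB.instance Definition _ := Choice.on LT.
HB.instance Definition _ := EqQuotient.on LT.

Definition cls (A : sentence) : LT := (\pi_LT A)%qT.

Lemma clsP A B : cls A = cls B <-> equiv A B.
Proof. by split=> [/eqP|h]; [rewrite /cls eqmodE|apply/eqP; rewrite /cls eqmodE]. Qed.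

Lemma cls_repr a : cls (repr a) = a. Proof. exact: reprK. Qed.

Definition LT_le (a b : LT) : bool := `[< entails (repr a) (repr b) >].
Definition LT_meet (a b : LT) : LT := cls (sand (repr a) (repr b)).
Definition LT_join (a b : LT) : LT := cls (sor (repr a) (repr b)).
Definition LT_compl (a : LT) : LT := cls (sneg (repr a)).
Definition LT_bot : LT := cls sfal.
Definition LT_top : LT := cls stru.

Lemma repr_cls A : entails (repr (cls A)) A /\ entails A (repr (cls A)).
Proof. by apply/equivP/clsP; rewrite cls_repr. Qed.

Lemma LT_le_cls A B : LT_le (cls A) (cls B) <-> entails A B.
Proof.
have [A1 A2] := repr_cls A; have [B1 B2] := repr_cls B.
split=> [/asboolP h|h]; last apply/asboolP.
  exact: entails_trans (entails_trans A2 h) B1.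
exact: entails_trans (entails_trans A1 h) B2.
Qed.

Lemma LT_ind (P : LT -> Prop) : (forall A, P (cls A)) -> forall a, P a.
Proof. by move=> h a; rewrite -(cls_repr a). Qed.

Lemma LT_le_refl : reflexive LT_le.
Proof. by elim/LT_ind=> A; apply/LT_le_cls/entails_refl. Qed.

Lemma LT_le_anti : antisymmetric LT_le.
Proof.
elim/LT_ind=> A; elim/LT_ind=> B /andP[/LT_le_cls h1 /LT_le_cls h2].
by apply/clsP/equivP.
Qed.

Lemma LT_le_trans : transitive LT_le.
Proof.
elim/LT_ind=> B; elim/LT_ind=> A; elim/LT_ind=> C /LT_le_cls h /LT_le_cls h'.
exact/LT_le_cls/(entails_trans h).
Qed.

Fact LT_display : Order.disp_t. Proof. exact: Order.Disp tt tt. Qed.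

HB.instance Definition _ :=
  Order.Le_isPOrder.Build LT_display LT LT_le_refl LT_le_anti LT_le_trans.

Lemma LT_leE (a b : LT) : (a <= b)%O = LT_le a b. Proof. by []. Qed.

Lemma entails_and A B C : entails A (sand B C) <-> entails A B /\ entails A C.
Proof.
split=> [/prv_impP/prv_andP[]|[/prv_impP h /prv_impP h']].
  by split; apply/prv_impI.
by apply/prv_impI/prv_andP.
Qed.

Lemma entails_or A B C : entails (sor A B) C <-> entails A C /\ entails B C.
Proof.
split=> [/prv_impP/prv_orE[]|[/prv_impP h /prv_impP h']].
  by split; apply/prv_impI.
by apply/prv_impI/prv_orE.
Qed.

Lemma LT_meetP (a b c : LT) : (a <= LT_meet b c)%O = (a <= b)%O && (a <= c)%O.
Proof.
rewrite !LT_leE -[in LHS](cls_repr a); apply/idP/andP.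
  by move=> /LT_le_cls/entails_and[? ?]; split; apply/asboolP.
by move=> [/asboolP ? /asboolP ?]; apply/LT_le_cls/entails_and.
Qed.

Lemma LT_joinP (a b c : LT) : (LT_join a b <= c)%O = (a <= c)%O && (b <= c)%O.
Proof.
rewrite !LT_leE -[in LHS](cls_repr c); apply/idP/andP.
  by move=> /LT_le_cls/entails_or[? ?]; split; apply/asboolP.
by move=> [/asboolP ? /asboolP ?]; apply/LT_le_cls/entails_or.
Qed.

HB.instance Definition _ :=
  Order.POrder_MeetJoin_isLattice.Build LT_display LT LT_meetP LT_joinP.

Lemma cls_and A B : cls (sand A B) = (cls A `&` cls B)%O.
Proof.
apply/eqP; rewrite eq_le lexI !LT_leE; apply/andP; split.
  by apply/andP; split; apply/LT_le_cls; have [] := (entails_and _ A B).1 (entails_refl _).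
rewrite -(cls_repr (cls A `&` cls B)%O); apply/LT_le_cls/entails_and.
by split; apply/LT_le_cls; rewrite cls_repr -LT_leE ?leIl ?leIr.
Qed.

Lemma cls_or A B : cls (sor A B) = (cls A `|` cls B)%O.
Proof.
apply/eqP; rewrite eq_le leUx !LT_leE; apply/andP; split; last first.
  by apply/andP; split; apply/LT_le_cls; have [] := (entails_or A B _).1 (entails_refl _).
rewrite -(cls_repr (cls A `|` cls B)%O); apply/LT_le_cls/entails_or.
by split; apply/LT_le_cls; rewrite cls_repr -LT_leE ?leUl ?leUr.
Qed.

Lemma LT_meetUl : left_distributive (@Order.meet _ LT) (@Order.join _ LT).
Proof.
elim/LT_ind=> A; elim/LT_ind=> B; elim/LT_ind=> C.
apply/le_anti/andP; split; last first.
  by rewrite leUx !leI2 // ?leUl ?leUr.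
rewrite -(cls_or A B) -(cls_and _ C) -(cls_and A C) -(cls_and B C).
rewrite -(cls_or (sand A C)) LT_leE; apply/LT_le_cls.
apply/prv_impI; have /prv_andP[hAB hC] := prv_hyp (sform @` T_fin) (And (Or A B) C).
apply: (prv_cut hAB); apply/prv_orE.
by split; [apply: prv_orl|apply: prv_orr]; apply/prv_andP;
  split; [apply: prv_hyp|apply: prv_wk|apply: prv_hyp|apply: prv_wk].
Qed.

HB.instance Definition _ :=
  Order.Lattice_Meet_isDistrLattice.Build LT_display LT LT_meetUl.

Lemma LT_le0x (a : LT) : (LT_bot <= a)%O.
Proof.
by rewrite LT_leE -(cls_repr a); apply/LT_le_cls/prv_impI/prv_exf/prv_hyp.
Qed.

Lemma LT_lex1 (a : LT) : (a <= LT_top)%O.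
Proof.
by rewrite LT_leE -(cls_repr a); apply/LT_le_cls/prv_impI/prv_impI/prv_hyp.
Qed.

HB.instance Definition _ := Order.hasBottom.Build LT_display LT LT_le0x.
HB.instance Definition _ := Order.hasTop.Build LT_display LT LT_lex1.

Lemma LT_joinxC (a : LT) : (a `|` LT_compl a)%O = \top%O.
Proof.
apply/le_anti; rewrite lex1 /= -[a in (a `|` _)%O]cls_repr -cls_or.
by apply/LT_le_cls/prv_impI/prv_em.
Qed.

Lemma LT_meetxC (a : LT) : (a `&` LT_compl a)%O = \bot%O.
Proof.
apply/le_anti; rewrite le0x andbT -[a in (a `&` _)%O]cls_repr -cls_and.
apply/LT_le_cls/prv_impI.
have /prv_andP[h1 h2] := prv_hyp (sform @` T_fin) (And (repr a) (Neg (repr a))).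
exact: prv_impE h2 h1.
Qed.

HB.instance Definition _ :=
  Order.TBDistrLattice_hasComplement.Build LT_display LT LT_joinxC LT_meetxC.

(* The operation + on classes, computed on representatives; the class of the
   sum does not depend on them. *)
Definition LT_plus (a b : LT) : LT := cls (splus (repr a) (repr b)).

Record relspace := RelSpace {
  carrier :> topologicalType;
  trel : carrier -> carrier -> carrier -> Prop }.

Definition relspace_iso (X Y : relspace) (f : X -> Y) : Prop :=
  [/\ bijective f,
      forall U : set Y, open U -> open (f @^-1` U),
      forall U : set X, open U -> open (f @` U) &
      forall x y z : X, trel x y z <-> trel (f x) (f y) (f z)].

Section StoneDual.
Context {d : Order.disp_t} (L : ctbDistrLatticeType d).

Record ultrafilter := Ultrafilter {
  uset :> L -> Prop;
  uf_top : uset \top%O;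
  uf_meet : forall a b, uset a -> uset b -> uset (a `&` b)%O;
  uf_up : forall a b, (a <= b)%O -> uset a -> uset b;
  uf_proper : ~ uset \bot%O;
  uf_ultra : forall a, uset a \/ uset (~` a)%O }.

HB.instance Definition _ := gen_eqMixin ultrafilter.
HB.instance Definition _ := gen_choiceMixin ultrafilter.

(* The topology with basis the sets of ultrafilters that contain some a. *)
Definition uf_open (U : set ultrafilter) : Prop :=
  forall u, U u -> exists2 a, u a & forall v : ultrafilter, v a -> U v.

Lemma uf_openT : uf_open setT.
Proof. by move=> u _; exists \top%O => //; apply: uf_top. Qed.

Lemma uf_openI (U V : set ultrafilter) : uf_open U -> uf_open V -> uf_open (U `&` V).
Proof.
move=> oU oV u [/oU[a ua aU] /oV[b ub bV]]; exists (a `&` b)%O; first exact: uf_meet.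
move=> v vab; split; [apply: aU|apply: bV]; apply: uf_up vab; [exact: leIl|exact: leIr].
Qed.

Lemma uf_open_bigU (I : Type) (F : I -> set ultrafilter) :
  (forall i, uf_open (F i)) -> uf_open (\bigcup_i F i).
Proof.
move=> oF u [i _ /oF[a ua aF]]; exists a => // v /aF ?; by exists i.
Qed.

HB.instance Definition _ :=
  isOpenTopological.Build ultrafilter uf_openT uf_openI uf_open_bigU.

Definition ext_stone_dual (op : L -> L -> L) : relspace :=
  @RelSpace ultrafilter
    (fun x y z => [set op a b | a in uset x & b in uset y] `<=` uset z).

End StoneDual.

Record S0 := MkS0 {
  cth :> sentence -> Prop;
  S0_ext : T_fin `<=` (cth : theory);
  S0_consistent : consistent cth;
  S0_complete : forall A : sentence, cth A \/ cth (sneg A) }.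

HB.instance Definition _ := gen_eqMixin S0.
HB.instance Definition _ := gen_choiceMixin S0.

Definition is_atom (T : Type) (le : T -> T -> Prop) (bot x : T) : Prop :=
  x <> bot /\ forall y, le y x -> y = bot \/ y = x.

Definition oplus_str (M N : structure) : structure :=
  let le (A B : M * N) := ssub A.1 B.1 /\ ssub A.2 B.2 in
  let bot := (sbot M, sbot N) in
  @Structure (M * N)%type le bot (is_atom le bot)
    (fun A B => (A.1 <> sbot M /\ B.2 <> sbot N) \/ slhd A.1 B.1 \/ slhd A.2 B.2).

(* The theory of the sum of M and N, for any models M of x and N of y: all
   choices of M and N give the same theory. *)
Definition oplus (x y : S0) : theory :=
  [set A : sentence | exists M N : structure,
     [/\ models M x, models N y & Th (oplus_str M N) A]].

Lemma S0_closed (x : S0) (A : sentence) : proves (cth x) A -> x A.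
Proof.
move=> h; have [//|nA] := S0_complete x A; case: (@S0_consistent x).
by apply: prv_impE h; apply: prv_ax; exists (sneg A).
Qed.

Lemma S0_entails (x : S0) A B : entails A B -> x A -> x B.
Proof.
move=> AB xA; apply: S0_closed; apply: (@prv_impE _ A).
  by apply: prv_weak AB => _ [C TC <-]; exists C => //; apply: S0_ext.
by apply: prv_ax; exists A.
Qed.

Lemma S0_and (x : S0) A B : x A -> x B -> x (sand A B).
Proof.
by move=> xA xB; apply/S0_closed/prv_andP; split; apply: prv_ax; [exists A|exists B].
Qed.

Lemma S0_fal (x : S0) : ~ x sfal.
Proof. by move=> h; apply: (@S0_consistent x); apply: prv_ax; exists sfal. Qed.

Lemma S0_tru (x : S0) : x stru.
Proof. exact/S0_closed/prv_impI/prv_hyp. Qed.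

Definition S0_open (U : set S0) : Prop :=
  forall x, U x -> exists2 A : sentence, x A & forall y : S0, y A -> U y.

Lemma S0_openT : S0_open setT.
Proof. by move=> x _; exists stru => //; apply: S0_tru. Qed.

Lemma S0_openI (U V : set S0) : S0_open U -> S0_open V -> S0_open (U `&` V).
Proof.
move=> oU oV x [/oU[A xA AU] /oV[B xB BV]]; exists (sand A B); first exact: S0_and.
have [hA hB] := (entails_and (sand A B) A B).1 (entails_refl _).
by move=> y yAB; split; [apply/AU/(S0_entails hA)|apply/BV/(S0_entails hB)].
Qed.

Lemma S0_open_bigU (I : Type) (F : I -> set S0) :
  (forall i, S0_open (F i)) -> S0_open (\bigcup_i F i).
Proof. by move=> oF x [i _ /oF[A xA AF]]; exists A => // y /AF ?; exists i. Qed.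

HB.instance Definition _ :=
  isOpenTopological.Build S0 S0_openT S0_openI S0_open_bigU.

Definition S0_space : relspace :=
  @RelSpace S0 (fun x y z => cth z = oplus x y).

Section UltrafilterOf.
Variable x : S0.

Let U : set LT := [set cls A | A in cth x].

Lemma ufE A : U (cls A) <-> x A.
Proof.
split=> [[B xB /clsP/equivP[BA _]]|xA]; last by exists A.
exact: S0_entails BA xB.
Qed.

Fact ufof_top : U \top%O. Proof. exact/ufE/S0_tru. Qed.

Fact ufof_meet a b : U a -> U b -> U (a `&` b)%O.
Proof.
move: a b; elim/LT_ind=> A; elim/LT_ind=> B /ufE xA /ufE xB.
by rewrite -cls_and; apply/ufE/S0_and.
Qed.

Fact ufof_up a b : (a <= b)%O -> U a -> U b.
Proof.
move: a b; elim/LT_ind=> A; elim/LT_ind=> B /LT_le_cls AB /ufE xA.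
exact/ufE/(S0_entails AB).
Qed.

Fact ufof_proper : ~ U \bot%O. Proof. by move=> /ufE/S0_fal. Qed.

Fact ufof_ultra a : U a \/ U (~` a)%O.
Proof.
rewrite -{1}(cls_repr a).
by have [xA|xA] := S0_complete x (repr a); [left|right]; apply/ufE.
Qed.

Definition uf_of : ultrafilter LT :=
  Ultrafilter ufof_top ufof_meet ufof_up ufof_proper ufof_ultra.

End UltrafilterOf.

(* Main.v *)
(* If z contains all the sums, a compactness argument gives a model K of z and
   one downward closed X in K such that K|X is a model of x and K|X^c one of y;
   mapping Z to its traces on X and X^c identifies K with (K|X) (+) (K|X^c).
   Conversely the set (top, bot) witnesses each sum in M (+) N.  Both directions
   rest on Th (M (+) N) being determined by Th M and Th N, which is a
   Feferman-Vaught argument.  Since + is computed on representatives in the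
   Lindenbaum-Tarski algebra, one also needs that K|X is a model of T_MSO(Fin)
   when K is: relativised comprehension, and the fact that the discreteness and
   endpoint axioms amount to the existence of greatest atoms. *)
Require Import Defs.
From mathcomp Require Import all_boot all_order zify.
From mathcomp Require Import boolp classical_sets topology_structure.

Set Implicit Arguments.
Unset Strict Implicit.
Unset Printing Implicit Defensive.

Local Open Scope classical_set_scope.

(** * Substitution and soundness *)

(** Compactness comes from a Henkin construction for open formulas. X is the free variable 0 of the
    set of formulas to be satisfied; the set has no other free index, so the larger indices are
    fresh and act as Henkin constants within the given language. Each sum carries its own
    existential quantifier over the complement, but a complement is determined by its atoms, so all
    sums share one Y once X is fixed. Satisfying finitely many sums reduces to satisfying one: $x$
    and $y$ are closed under conjunction, and relativisation commutes with it.

    Models of $T_{\mathrm{base}}$ are handled through atoms: an element is determined by the atoms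
    below it, and comprehension supplies the meets, joins, complements and definable sets that the
    arguments call for. *)

Lemma sh_up s t : subst_term (up s) (sh t) = sh (subst_term s t).
Proof. by case: t. Qed.

Lemma subst_term_comp s1 s2 t :
  subst_term s2 (subst_term s1 t) = subst_term (subst_term s2 \o s1) t.
Proof. by case: t. Qed.

Lemma up_comp s1 s2 : subst_term (up s2) \o up s1 = up (subst_term s2 \o s1).
Proof. by apply/funext => -[|i] //=; rewrite sh_up. Qed.

Lemma subst_comp s1 s2 A : subst s2 (subst s1 A) = subst (subst_term s2 \o s1) A.
Proof.
elim: A s1 s2 => [|t u|t u|t|t u|B IHB C IHC|B IHB] s1 s2 //=;
  rewrite ?subst_term_comp ?IHB ?IHC //.
by rewrite up_comp.
Qed.

Lemma subst_id A : subst tvar A = A.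
Proof.
have tE t : subst_term tvar t = t by case: t.
have upE : up tvar = tvar by apply/funext => -[].
by elim: A => [|t u|t u|t|t u|B IHB C IHC|B IHB] //=; rewrite ?tE ?upE ?IHB ?IHC.
Qed.

Lemma eq_subst_bnd n s1 s2 A : (forall i, i < n -> s1 i = s2 i) ->
  bnd n A -> subst s1 A = subst s2 A.
Proof.
have tE m f1 f2 t : (forall i, i < m -> f1 i = f2 i) -> tbnd m t ->
  subst_term f1 t = subst_term f2 t by case: t => //= i; apply.
elim: A n s1 s2 => [|t u|t u|t|t u|B IHB C IHC|B IHB] n s1 s2 hs //=.
1,2,4: by move=> /andP[/(tE _ _ _ _ hs)-> /(tE _ _ _ _ hs)->].
- by move=> /(tE _ _ _ _ hs)->.
- by move=> /andP[/(IHB _ _ _ hs)-> /(IHC _ _ _ hs)->].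
- by move=> hB; rewrite (IHB n.+1 (up s1) (up s2)) // => -[|i] //= /hs->.
Qed.

Lemma subst_inst s t A :
  subst s (inst t A) = inst (subst_term s t) (subst (up s) A).
Proof.
rewrite /inst !subst_comp; congr subst; apply/funext => -[|i] //=.
by case: (s i).
Qed.

Lemma subst_shift s A : subst (up s) (shift A) = shift (subst s A).
Proof. by rewrite /shift !subst_comp. Qed.

Lemma prv_subst s G A : prv G A -> prv (subst s @` G) (subst s A).
Proof.
move=> d; elim: d s => {G A} [G A GA|G A B _ IH|G A B _ IH1 _ IH2|G A _ IH
  |G A _ IH|G A t _ IH|G t|G A t u _ IH1 _ IH2] s.
- by apply: prv_ax; exists A.
- by apply/prv_impI/(prv_weak _ (IH s)) => _ [C [->|GC] <-]; [left|right; exists C].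
- exact: prv_impE (IH1 s) (IH2 s).
- by apply/prv_raa/(prv_weak _ (IH s)) => _ [C [->|GC] <-]; [left|right; exists C].
- apply/prv_allI/(prv_weak _ (IH (up s))) => _ [_ [C GC <-] <-].
  by rewrite subst_shift; exists (subst s C) => //; exists C.
- by rewrite subst_inst; apply/prv_allE/IH.
- exact: prv_eqI.
- rewrite subst_inst; apply: prv_eqE (IH1 s) _.
  by rewrite -subst_inst; apply: IH2.
Qed.

(** The renaming that sends [c] to 0 and shifts every other index turns [inst (tvar c) B] back into
    [B] and each member of [G] into its shift, which is the premise of [prv_allI]. *)
Lemma prv_fresh n c G B : (forall C, G C -> bnd n C) -> bnd n.+1 B -> n <= c ->
  prv G (inst (tvar c) B) -> prv G (All B).
Proof.
move=> hG hB nc /(prv_subst (fun i => if i == c then tvar 0 else tvar i.+1)).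
set s := fun _ => _; have -> : subst s (inst (tvar c) B) = B.
  rewrite /inst subst_comp -[RHS]subst_id; apply: eq_subst_bnd hB => -[|i] /=.
    by rewrite /s eqxx.
  by rewrite ltnS /s => /leq_trans/(_ nc)/ltn_eqF ->.
move=> d; apply/prv_allI/(prv_weak _ d) => _ [C GC <-]; exists C => //.
by apply: eq_subst_bnd (hG _ GC) => i ic; rewrite /s ltn_eqF // (leq_trans ic).
Qed.

(** * Finiteness of derivations *)

Lemma prv_finite G A : prv G A ->
  exists2 l : seq form, (forall B, B \in l -> G B) & prv [set` l] A.
Proof.
have W (l l' : seq form) C : {subset l <= l'} -> prv [set` l] C -> prv [set` l'] C.
  by move=> s; apply: prv_weak => B /s.
have D (l : seq form) B H C : (forall D, D \in l -> (B |` H) D) ->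
    prv [set` l] C -> exists2 l' : seq form, (forall D, D \in l' -> H D) &
    prv (B |` [set` l']) C.
  move=> hl d; exists [seq D <- l | D != B].
    by move=> E; rewrite mem_filter => /andP[/eqP nE /hl[]].
  apply: prv_weak d => E El; have [->|nE] := eqVneq E B; first by left.
  by right; rewrite /= mem_filter nE.
elim=> {G A} [G A GA|G A B _ [l hl d]|G A B _ [l1 hl1 d1] _ [l2 hl2 d2]|G A _ [l hl d]
  |G A _ [l hl d]|G A t _ [l hl d]|G t|G A t u _ [l1 hl1 d1] _ [l2 hl2 d2]].
- exists [:: A]; first by move=> B; rewrite inE => /eqP->.
  by apply: prv_ax; rewrite /= inE.
- by have [l' ? ?] := D _ _ _ _ hl d; exists l' => //; apply: prv_impI.
- exists (l1 ++ l2).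
    by move=> C; rewrite mem_cat => /orP[/hl1|/hl2].
  by apply: prv_impE (W _ _ _ _ d1) (W _ _ _ _ d2) => C; rewrite mem_cat => ->; rewrite ?orbT.
- by have [l' ? ?] := D _ _ _ _ hl d; exists l' => //; apply: prv_raa.
- have [l' hl' sl] : exists2 l' : seq form, (forall B, B \in l' -> G B) &
      {subset l <= map shift l'}.
    elim: l hl {d} => [|B l IH] hl; first by exists [::].
    have [C Bl|l' hl' sl] := IH; first by apply: hl; rewrite inE Bl orbT.
    have [C GC CB] := hl B (mem_head _ _); exists (C :: l').
      by move=> E; rewrite inE => /orP[/eqP->|/hl'].
    move=> E; rewrite /= !inE CB => /orP[->|/sl ->] //; by rewrite orbT.
  exists l' => //; apply/prv_allI/(prv_weak _ d) => B /sl/mapP[C Cl ->].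
  by exists C.
- by exists l => //; apply: prv_allE.
- by exists [::] => //; apply: prv_eqI.
- exists (l1 ++ l2).
    by move=> C; rewrite mem_cat => /orP[/hl1|/hl2].
  by apply: prv_eqE (W _ _ _ _ d1) (W _ _ _ _ d2) => C; rewrite mem_cat => ->; rewrite ?orbT.
Qed.

(** A derivation uses finitely many hypotheses, so they can be discharged one at a time and each
    replaced by its own derivation from [H]. *)
Lemma prv_cuts G H A : (forall B, G B -> prv H B) -> prv G A -> prv H A.
Proof.
move=> GH /prv_finite[l + d].
elim: l A d => [|B l IH] A d hl; first by apply: prv_weak d => B.
apply: (prv_impE (A := B)); last by apply/GH/hl/mem_head.
apply: IH => [|C Cl]; last by apply: hl; rewrite inE Cl orbT.
apply: prv_impI; apply: prv_weak d => C /=; rewrite inE => /orP[/eqP->|]; [by left|by right].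
Qed.

Lemma teval_subst (M : structure) (e : nat -> M) s t :
  teval e (subst_term s t) = teval (teval e \o s) t.
Proof. by case: t. Qed.

Lemma sat_subst (M : structure) (e : nat -> M) s A :
  sat e (subst s A) = sat (teval e \o s) A.
Proof.
elim: A s e => [|t u|t u|t|t u|B IHB C IHC|B IHB] s e //=;
  rewrite ?teval_subst ?IHB ?IHC //.
apply: eq_forall => a; rewrite IHB; congr sat; apply/funext => -[|i] //=.
by case: (s i).
Qed.

Lemma sat_inst (M : structure) (e : nat -> M) t A :
  sat e (inst t A) = sat (scons (teval e t) e) A.
Proof. by rewrite /inst sat_subst; congr sat; apply/funext => -[]. Qed.

Lemma sat_shift (M : structure) (e : nat -> M) a A :
  sat (scons a e) (shift A) = sat e A.
Proof. by rewrite /shift sat_subst. Qed.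

Lemma soundness G A : prv G A -> forall (M : structure) (e : nat -> M),
  (forall B, G B -> sat e B) -> sat e A.
Proof.
elim=> {G A} [G A GA|G A B _ IH|G A B _ IH1 _ IH2|G A _ IH
  |G A _ IH|G A t _ IH|G t|G A t u _ IH1 _ IH2] M e hG //=.
- exact: hG.
- by move=> hA; apply: IH => C [->|/hG].
- exact: (IH1 _ _ hG) (IH2 _ _ hG).
- by apply: contrapT => nA; apply: (IH M e) => C [->|/hG].
- by move=> a; apply: IH => _ [C GC <-]; rewrite sat_shift; apply: hG.
- by rewrite sat_inst; apply: (IH _ _ hG).
- have := IH2 _ _ hG; have /= E := IH1 _ _ hG; by rewrite !sat_inst E.
Qed.

(** * Model existence *)

(** Finitely branching trees over [nat] are countable; coding formulas as such trees yields the
    enumeration [form_enum] along which the Henkin chain runs. *)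
Definition term_code (t : term) : GenTree.tree nat :=
  if t is tvar i then GenTree.Leaf i else GenTree.Node 0 [::].

Definition term_decode (c : GenTree.tree nat) : term :=
  if c is GenTree.Leaf i then tvar i else tbot.

Fixpoint form_code (A : form) : GenTree.tree nat :=
  match A with
  | Fal => GenTree.Node 0 [::]
  | EqF t u => GenTree.Node 1 [:: term_code t; term_code u]
  | SubF t u => GenTree.Node 2 [:: term_code t; term_code u]
  | At t => GenTree.Node 3 [:: term_code t]
  | Lhd t u => GenTree.Node 4 [:: term_code t; term_code u]
  | Imp B C => GenTree.Node 5 [:: form_code B; form_code C]
  | All B => GenTree.Node 6 [:: form_code B]
  end.

Fixpoint form_decode (c : GenTree.tree nat) : form :=
  match c with
  | GenTree.Node 1 [:: t; u] => EqF (term_decode t) (term_decode u)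
  | GenTree.Node 2 [:: t; u] => SubF (term_decode t) (term_decode u)
  | GenTree.Node 3 [:: t] => At (term_decode t)
  | GenTree.Node 4 [:: t; u] => Lhd (term_decode t) (term_decode u)
  | GenTree.Node 5 [:: b; c] => Imp (form_decode b) (form_decode c)
  | GenTree.Node 6 [:: b] => All (form_decode b)
  | _ => Fal
  end.

Lemma form_codeK : cancel form_code form_decode.
Proof.
have tK : cancel term_code term_decode by case.
by elim=> [|t u|t u|t|t u|B IHB C IHC|B IHB] //=; rewrite ?tK ?IHB ?IHC.
Qed.

Definition form_enum (n : nat) : form :=
  if unpickle n is Some c then form_decode c else Fal.

Lemma form_enum_pickle A : form_enum (pickle (form_code A)) = A.
Proof. by rewrite /form_enum pickleK form_codeK. Qed.

Lemma bnd_leq n m A : n <= m -> bnd n A -> bnd m A.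
Proof.
elim: A n m => [|t u|t u|t|t u|B IHB C IHC|B IHB] n m nm //=.
1,2,4: by move=> /andP[/(tbnd_leq nm)-> /(tbnd_leq nm)->].
- exact: tbnd_leq.
- by move=> /andP[/(IHB _ _ nm)-> /(IHC _ _ nm)->].
- exact: IHB.
Qed.

Lemma bnd_ex A : exists n, bnd n A.
Proof.
have tE t : exists n, tbnd n t by case: t => [i|]; [exists i.+1 => /=|exists 0].
have J (b1 b2 : nat -> bool) : (forall n m, n <= m -> b1 n -> b1 m) ->
    (forall n m, n <= m -> b2 n -> b2 m) -> (exists n, b1 n) -> (exists n, b2 n) ->
    exists n, b1 n && b2 n.
  move=> m1 m2 [n1 h1] [n2 h2]; exists (maxn n1 n2).
  by rewrite (m1 _ _ _ h1) ?leq_maxl // (m2 _ _ _ h2) ?leq_maxr.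
elim: A => [|t u|t u|t|t u|B IHB C IHC|B [n hn]] //=.
- by exists 0.
1-3: exact: J (fun n m => @tbnd_leq n m _) (fun n m => @tbnd_leq n m _) (tE t) (tE u).
- exact: J (fun n m => @bnd_leq n m _) (fun n m => @bnd_leq n m _) IHB IHC.
- by exists n; apply: bnd_leq hn.
Qed.

Definition bound A : nat := xchoose (bnd_ex A).

Lemma bnd_bound A : bnd (bound A) A.
Proof. exact: (xchooseP (P := fun n => bnd n A) (bnd_ex A)). Qed.

(** * Complete consistent sets with counterexamples to refuted universal formulas *)

Section Henkin.
Variables (k : nat) (G : set form).
Hypotheses (G_bnd : forall C, G C -> bnd k C) (G_cons : ~ prv G Fal).

Definition henkin_witness (c : nat) (A : form) : set form :=
  if A is Imp (All B) Fal then [set Neg (inst (tvar c) B)] else set0.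

(* The second component bounds the free variables of the first, so that it is
   itself a fresh variable, usable as a witness. *)
Definition henkin_step (p : set form * nat) (A : form) : set form * nat :=
  if `[< prv (A |` p.1) Fal >] then p else
  let c := maxn p.2 (bound A) in
  (henkin_witness c A `|` (A |` p.1), c.+1).

Fixpoint henkin_chain (n : nat) : set form * nat :=
  if n is m.+1 then henkin_step (henkin_chain m) (form_enum m) else (G, k).

Lemma bnd_inst_var n c B : bnd n.+1 B -> c < n -> bnd n (inst (tvar c) B).
Proof. by move=> hB cn; apply: bnd_subst hB => -[|i]. Qed.

Lemma henkin_witnessE c A : henkin_witness c A = set0 \/
  exists B, A = Neg (All B) /\ henkin_witness c A = [set Neg (inst (tvar c) B)].
Proof.
case: A => [|? ?|? ?|?|? ?|[|? ?|? ?|?|? ?|? ?|B] [|? ?|? ?|?|? ?|? ?|?]|?];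
  by [left|right; exists B].
Qed.

Lemma henkin_chainP n : (forall C, (henkin_chain n).1 C -> bnd (henkin_chain n).2 C) /\
  ~ prv (henkin_chain n).1 Fal.
Proof.
elim: n => //= n; case: (henkin_chain n) => [P m] /= [hb hc].
set A := form_enum n; rewrite /henkin_step /=.
case: asboolP => [//|hA] /=.
set c := maxn m (bound A).
have bA : bnd c A by apply: bnd_leq (bnd_bound A); apply: leq_maxr.
have bP C : (A |` P) C -> bnd c C.
  by move=> [->//|/hb]; apply: bnd_leq; apply: leq_maxl.
have [->|[B [EA ->]]] := henkin_witnessE c A.
  by rewrite set0U; split=> // C [//|/bP]; apply: bnd_leq.
have bB : bnd c.+1 B by move: bA; rewrite EA /= andbT.
split=> [C [->|/bP]|]; last 1 first.
(* If the new counterexample were contradictory, [inst (tvar c) B] would be derivable without it,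
   hence [All B] by freshness of [c], against [A] being its negation. *)
- move=> /prv_raa /(prv_fresh bP bB (leqnn _)) h; apply: hA.
  by apply: prv_impE h; rewrite EA; apply: prv_hyp.
- by rewrite /= andbT bnd_inst_var //; apply: bnd_leq bB.
- exact: bnd_leq.
Qed.

Lemma henkin_chain_mono n m : n <= m -> (henkin_chain n).1 `<=` (henkin_chain m).1.
Proof.
move=> /subnKC <-; elim: (m - n) => [|d IH]; first by rewrite addn0.
rewrite addnS /= /henkin_step; case: asboolP => // _ A /IH hA.
by right; right.
Qed.

Lemma henkin_extension : exists H : set form,
  [/\ G `<=` H, ~ H Fal, forall A, prv H A -> H A, forall A, H A \/ H (Neg A) &
      forall B, (forall t, H (inst t B)) -> H (All B)].
Proof.
pose H : set form := \bigcup_n (henkin_chain n).1.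
have Hn n : (henkin_chain n).1 `<=` H by move=> A hA; exists n.
have Hcons : ~ prv H Fal.
  move=> /prv_finite[l hl]; suff [n hn] : exists n, [set` l] `<=` (henkin_chain n).1.
    by move=> /(prv_weak hn); apply: (henkin_chainP n).2.
  elim: l hl => [|B l IH] hl; first by exists 0.
  have [C Cl|n hn] := IH; first by apply: hl; rewrite inE Cl orbT.
  have [m _ hm] := hl _ (mem_head _ _); exists (maxn n m) => C /=.
  rewrite inE => /orP[/eqP->|/hn].
    by apply: henkin_chain_mono hm; apply: leq_maxr.
  by apply: henkin_chain_mono; apply: leq_maxl.
(* Stage [idx A] is one that examines [A]; if [A] is rejected there, the chain already refutes it,
   and so does [H]. *)
pose idx A := pickle (form_code A).
have Hadd A : ~ prv (A |` (henkin_chain (idx A)).1) Fal ->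
    H A /\ exists c, henkin_witness c A `<=` H.
  move=> hA; have E : (henkin_chain (idx A).+1) =
    henkin_step (henkin_chain (idx A)) A by rewrite /= form_enum_pickle.
  have := Hn (idx A).+1; rewrite E /henkin_step; case: asboolP => //= _ s.
  by split; [apply: s; right; left|eexists => B hB; apply: s; left; exact: hB].
have Hcompl A : H A \/ prv H (Neg A).
  have [h|/Hadd[]] := pselect (prv (A |` (henkin_chain (idx A)).1) Fal); last by left.
  by right; apply: prv_impI; apply: prv_weak h; apply: setUS.
have Hcl A : prv H A -> H A.
  by move=> hA; have [//|nA] := Hcompl A; case: Hcons; apply: prv_impE hA.
exists H; split=> //.
- exact: Hn 0.
- by move=> hF; apply/Hcons/prv_ax.
- by move=> A; have [|/Hcl] := Hcompl A; [left|right].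
- move=> B hB; have [//|nB] := Hcompl (All B); exfalso.
  have [|_ [c hc]] := Hadd (Neg (All B)).
    move=> h; apply: Hcons; exact: prv_impE (prv_impI (prv_weak (setUS (Hn _)) h)) nB.
  by apply/Hcons/(prv_impE (prv_ax (hc _ erefl)))/prv_ax.
Qed.

End Henkin.

(** The points are equivalence classes taken as predicates, and [r] chooses representatives, through
    which the relations of the term model are defined. *)
Lemma quotient_ex (T : Type) (E : T -> T -> Prop) : (forall t, E t t) ->
  (forall t u v, E t u -> E t v -> E u v) ->
  exists (D : Type) (p : T -> D) (r : D -> T),
    (forall d, p (r d) = d) /\ forall t u, p t = p u <-> E t u.
Proof.
move=> Er Et; have Es t u : E t u -> E u t by move=> h; apply: Et h (Er t).
pose D := {S : set T | exists t, S = E t}.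
pose p t : D := exist _ (E t : set T) (ex_intro _ t erefl).
pose r (d : D) : T := sval (cid (proj2_sig d)).
have pE t u : p t = p u <-> E t u.
  split=> [[->]//|tu]; apply: eq_exist; apply/funext => v; apply/propext.
  by split; apply: Et => //; apply: Es.
exists D, p, r; split=> // -[S hS]; apply: eq_exist => /=.
by rewrite /r /=; case: cid.
Qed.

(** * The model of terms modulo provable equality *)

Section TermModel.
Variable H : set form.
Hypotheses (H_cons : ~ H Fal) (H_closed : forall A, prv H A -> H A).
Hypotheses (H_complete : forall A, H A \/ H (Neg A)).
Hypothesis (H_all : forall B, (forall t, H (inst t B)) -> H (All B)).

Lemma henkin_impP B C : H (Imp B C) <-> (H B -> H C).
Proof.
split=> [h hB|h]; first by apply/H_closed/(prv_impE (prv_ax h))/prv_ax.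
apply/H_closed/prv_impI; have [/h hC|hB] := H_complete B.
  exact/prv_wk/prv_ax.
by apply/prv_exf/(prv_impE (prv_wk _ (prv_ax hB)))/prv_hyp.
Qed.

Lemma henkin_allP B : H (All B) <-> forall t, H (inst t B).
Proof. by split=> [h t|/H_all//]; apply/H_closed/prv_allE/prv_ax. Qed.

Lemma henkin_eq A t u : H (EqF t u) -> H (inst t A) -> H (inst u A).
Proof. by move=> h1 h2; apply/H_closed/(prv_eqE (prv_ax h1))/prv_ax. Qed.

Lemma term_model : exists (M : structure) (e : nat -> M), forall A, sat e A <-> H A.
Proof.
pose E t u := H (EqF t u).
have inst_sh t u : subst_term (fun i => if i is j.+1 then tvar j else t) (sh u) = u.
  by case: u.
have Er t : E t t by apply/H_closed/prv_eqI.
have Et t u v : E t u -> E t v -> E u v.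
  move=> tu tv; have := henkin_eq (A := EqF (tvar 0) (sh v)) tu.
  by rewrite /inst /= !inst_sh; apply.
have Es t u : E t u -> E u t by move=> h; apply: Et h (Er t).
have [D [p [r [rK pE]]]] := quotient_ex Er Et.
have rp t : E (r (p t)) t by apply/pE; rewrite rK.
pose M := @Structure D (fun a b => H (SubF (r a) (r b))) (p tbot)
  (fun a => H (At (r a))) (fun a b => H (Lhd (r a) (r b))).
have cong (F : term -> term -> form) t u t' u' :
    (forall s t u, subst s (F t u) = F (subst_term s t) (subst_term s u)) ->
    E t t' -> E u u' -> H (F t u) -> H (F t' u').
  move=> FE tt' uu' h.
  have := henkin_eq (A := F (tvar 0) (sh u)) tt'.
  rewrite /inst !FE /= !inst_sh => /(_ h) h'.
  have := henkin_eq (A := F (sh t') (tvar 0)) uu'.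
  by rewrite /inst !FE /= !inst_sh => /(_ h').
have teE s t : teval (M := M) (p \o s) t = p (subst_term s t) by case: t.
have congP F t u : (forall s t u, subst s (F t u) = F (subst_term s t) (subst_term s u)) ->
    H (F (r (p t)) (r (p u))) <-> H (F t u).
  by move=> FE; split; apply: cong => //; do ?[exact: rp|exact/Es/rp].
(* A quantifier extends the valuation by an arbitrary class, so the induction runs over all
   substitutions [s]; the identity [tvar] gives the claim. *)
suff S A s : sat (M := M) (p \o s) A <-> H (subst s A).
  by exists M, (p \o tvar) => A; have := S A tvar; rewrite subst_id.
elim: A s => [|t u|t u|t|t u|B IHB C IHC|B IHB] s /=; rewrite ?teE.
- by split.
- exact: pE.
- exact: (congP SubF).
- exact: (congP (fun t _ => At t) _ t).
- exact: (congP Lhd).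
- by rewrite henkin_impP IHB IHC.
- rewrite henkin_allP; have IE t : inst t (subst (up s) B) = subst (scons t s) B.
    by rewrite /inst subst_comp; congr subst; apply/funext => -[|i] /=.
  have sE t : scons (p t) (p \o s) = p \o scons t s by apply/funext => -[].
  split=> [h t|h a]; first by rewrite IE -IHB -sE; apply: h.
  by rewrite -(rK a) sE IHB -IE; apply: h.
Qed.

End TermModel.

Theorem model_existence k (G : set form) : (forall C, G C -> bnd k C) ->
  ~ prv G Fal -> exists (M : structure) (e : nat -> M), forall A, G A -> sat e A.
Proof.
move=> bG cG; have [H [GH nF cl co al]] := henkin_extension bG cG.
have [M [e he]] := term_model nF cl co al.
by exists M, e => A /GH /he.
Qed.

(** * Truth in a structure *)

Lemma sat_and (M : structure) (e : nat -> M) A B : sat e (And A B) = (sat e A /\ sat e B).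
Proof.
apply/propext; split=> [h|[hA hB] /=]; last exact.
by split; apply: contrapT => n; apply: h => /= hA //.
Qed.

Lemma sat_or (M : structure) (e : nat -> M) A B : sat e (Or A B) = (sat e A \/ sat e B).
Proof.
apply/propext; split=> [h|[hA|hB] //= _ //].
by have [|/h] := pselect (sat e A); [left|right].
Qed.

Lemma sat_iff (M : structure) (e : nat -> M) A B : sat e (Iff A B) = (sat e A <-> sat e B).
Proof. by rewrite /Iff sat_and. Qed.

Lemma sat_ex (M : structure) (e : nat -> M) A :
  sat e (Ex A) = exists a : M, sat (scons a e) A.
Proof.
apply/propext; split=> [h|[a ha] /(_ a)] //=.
by apply: contrapT => n; apply: h => a ha; apply: n; exists a.
Qed.

(* [sat] read through the abbreviations [And], [Ex], [Or] and [Neg], so that on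
   a concrete axiom it computes to the intended proposition. *)
Fixpoint den (M : structure) (e : nat -> M) (A : form) : Prop :=
  match A with
  | Fal => False
  | EqF t u => teval e t = teval e u
  | SubF t u => ssub (teval e t) (teval e u)
  | At t => sAt (teval e t)
  | Lhd t u => slhd (teval e t) (teval e u)
  | Imp (Imp B (Imp C Fal)) Fal => den e B /\ den e C
  | Imp (All (Imp B Fal)) Fal => exists a : M, den (scons a e) B
  | Imp (Imp (Imp _ (Imp _ Fal)) Fal as B) C => den e B -> den e C
  | Imp (Imp (All (Imp _ Fal)) Fal as B) C => den e B -> den e C
  | Imp (Imp B Fal) C => den e B \/ den e C
  | Imp B Fal => ~ den e B
  | Imp B C => den e B -> den e C
  | All B => forall a : M, den (scons a e) B
  end.

Fixpoint fsize (A : form) : nat :=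
  match A with
  | Imp B C => (fsize B + fsize C).+1
  | All B => (fsize B).+1
  | _ => 1
  end.

Lemma den_imp (M : structure) (e : nat -> M) B C : den e (Imp B C) =
  match Imp B C with
  | Imp (Imp B1 (Imp C1 Fal)) Fal => den e B1 /\ den e C1
  | Imp (All (Imp B1 Fal)) Fal => exists a : M, den (scons a e) B1
  | Imp (Imp (Imp _ (Imp _ Fal)) Fal as B1) C1 => den e B1 -> den e C1
  | Imp (Imp (All (Imp _ Fal)) Fal as B1) C1 => den e B1 -> den e C1
  | Imp (Imp B1 Fal) C1 => den e B1 \/ den e C1
  | Imp B1 Fal => ~ den e B1
  | _ => den e B -> den e C
  end.
Proof. by []. Qed.

(** The clauses of [den] look several constructors deep, so the induction is on [fsize] rather than
    on the formula. The clauses for implications whose premise is an [And] or an [Ex] keep these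
    from being read as disjunctions, since such a premise is itself a negation. *)
Lemma satE (M : structure) (e : nat -> M) A : sat e A = den e A.
Proof.
move: {2}(fsize A).+1 (ltnSn (fsize A)) => n.
elim: n A e => // n IH [|t u|t u|t|t u|B C|B] e // hn; last first.
  exact: (eq_forall (fun a => IH B (scons a e) hn)).
have IHb : sat e B = den e B by apply: IH; move: hn => /=; lia.
have IHc : sat e C = den e C by apply: IH; move: hn => /=; lia.
have impE : sat e (Imp B C) = (den e B -> den e C) by rewrite -IHb -IHc.
rewrite den_imp.
repeat (match goal with
 | |- context[match ?x with Fal => _ | EqF _ _ => _ | _ => _ end] => is_var x; destruct x
 end; lazy iota beta); try exact: impE.
all: first [rewrite -[LHS]/(sat e (And _ _)) sat_and; congr and; apply: IH; move: hn => /=; lia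
  | rewrite -[LHS]/(sat e (Ex _)) sat_ex; apply: eq_exists => a; apply: IH; move: hn => /=; lia
  | rewrite -[LHS]/(sat e (Or _ _)) sat_or; congr or; apply: IH; move: hn => /=; lia].
Qed.

(** * Models of T_base as algebras of sets of atoms *)

Lemma sat_iter_All (M : structure) n A :
  (forall e : nat -> M, sat e (iter n All A)) <-> forall e : nat -> M, sat e A.
Proof.
elim: n => //= n IH; split=> h => [|e a]; last exact: IH.2 h _.
apply: IH.1 => e; have -> : e = scons (e 0) (fun i => e i.+1) by apply/funext => -[].
exact: h.
Qed.

Lemma holds_comp_form (M : structure) n A : holds M (comp_form n A) <->
  forall e : nat -> M, exists X : M, forall a : M, sAt a ->
    ssub a X <-> sat (scons a e) A.
Proof.
rewrite /holds /comp_form sat_iter_All.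
suff E (e : nat -> M) : sat e (Ex (AllAt (Iff (SubF (tvar 0) (tvar 1))
    (subst (fun i => if i is j.+1 then tvar j.+2 else tvar 0) A)))) =
    exists X : M, forall a : M, sAt a -> ssub a X <-> sat (scons a e) A.
  by split=> h e; move: (h e); rewrite E.
set s := fun _ => _; have F X a : sat (scons a (scons X e))
    (Iff (SubF (tvar 0) (tvar 1)) (subst s A)) = (ssub a X <-> sat (scons a e) A).
  by rewrite sat_iff sat_subst; congr (_ <-> sat _ _); apply/funext => -[].
rewrite sat_ex; apply: eq_exists => X.
apply/propext; split=> h a ha; first by rewrite -F; apply: (h a ha).
by move: (h a ha); rewrite -F.
Qed.

(** [ssub_atomsP] and [atom_compr] stand for the Boolean axioms: elements are sets of atoms, and
    comprehension yields the operations. The fields on [slhd] have the shape that [den] computes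
    from the axioms. *)
Record set_algebra (M : structure) : Prop := {
  ssub_anti : forall X Y : M, ssub X Y -> ssub Y X -> X = Y;
  ssub_atomsP : forall X Y : M, ssub X Y <-> forall a : M, sAt a -> ssub a X -> ssub a Y;
  bot_sub : forall X : M, ssub (sbot M) X;
  atomP : forall a : M, sAt a <-> is_atom (@ssub M) (sbot M) a;
  atom_compr : forall A (e : nat -> M), exists X : M, forall a : M, sAt a ->
    ssub a X <-> sat (scons a e) A;
  lhd_irr : forall a : M, sAt a -> ~ slhd a a;
  lhd_trans : forall a : M, sAt a -> forall b : M, sAt b -> forall c : M, sAt c ->
    slhd a b /\ slhd b c -> slhd a c;
  lhd_total : forall a : M, sAt a -> forall b : M, sAt b ->
    slhd a b \/ a = b \/ slhd b a;
  lhdP : forall X Y : M, slhd X Y <-> exists a : M, sAt a /\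
    exists b : M, sAt b /\ ssub a X /\ ssub b Y /\ slhd a b }.

Section SetAlgebra.
Variables (M : structure) (hM : set_algebra M).

Lemma ssub_refl (X : M) : ssub X X.
Proof. exact/(ssub_atomsP hM). Qed.

Lemma ssub_trans (X Y Z : M) : ssub X Y -> ssub Y Z -> ssub X Z.
Proof. by rewrite !(ssub_atomsP hM) => XY YZ a ha /(XY a ha)/(YZ a ha). Qed.

Lemma atoms_eq (X Y : M) : (forall a : M, sAt a -> ssub a X <-> ssub a Y) -> X = Y.
Proof. by move=> h; apply: (ssub_anti hM); apply/(ssub_atomsP hM) => a ha /(h a ha). Qed.

Lemma ssub_bot (X : M) : ssub X (sbot M) -> X = sbot M.
Proof. by move=> h; apply: (ssub_anti hM) => //; apply: bot_sub. Qed.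

Lemma atom_not_bot (a : M) : sAt a -> ~ ssub a (sbot M).
Proof. by move=> /(atomP hM)[+ _] /ssub_bot. Qed.

Lemma atom_sub_atom (a b : M) : sAt a -> sAt b -> ssub a b -> a = b.
Proof.
move=> ha /(atomP hM)[_ h] /h[E|//].
by case: (atom_not_bot ha); rewrite E; apply: ssub_refl.
Qed.

Lemma ex_atom (X : M) : X <> sbot M -> exists2 a : M, sAt a & ssub a X.
Proof.
move=> nX; apply: contrapT => h; apply/nX/ssub_bot/(ssub_atomsP hM) => a ha aX.
by case: h; exists a.
Qed.

Lemma atom_neq_bot (a X : M) : sAt a -> ssub a X -> X <> sbot M.
Proof. by move=> ha aX E; apply: (atom_not_bot ha); rewrite -E. Qed.

Let e0 : nat -> M := fun=> sbot M.

Lemma meet_atoms (X Y : M) : exists Z : M, forall a : M, sAt a ->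
  ssub a Z <-> ssub a X /\ ssub a Y.
Proof.
have [Z hZ] := atom_compr hM (And (SubF (tvar 0) (tvar 1)) (SubF (tvar 0) (tvar 2)))
  (scons X (scons Y e0)).
by exists Z => a /hZ; rewrite satE.
Qed.

Lemma join_atoms (X Y : M) : exists Z : M, forall a : M, sAt a ->
  ssub a Z <-> ssub a X \/ ssub a Y.
Proof.
have [Z hZ] := atom_compr hM (Or (SubF (tvar 0) (tvar 1)) (SubF (tvar 0) (tvar 2)))
  (scons X (scons Y e0)).
by exists Z => a /hZ; rewrite satE.
Qed.

Lemma compl_atoms (X : M) : exists Z : M, forall a : M, sAt a ->
  ssub a Z <-> ~ ssub a X.
Proof.
have [Z hZ] := atom_compr hM (Neg (SubF (tvar 0) (tvar 1))) (scons X e0).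
by exists Z => a /hZ; rewrite satE.
Qed.

Lemma top_atoms : exists Z : M, forall X : M, ssub X Z.
Proof.
have [Z hZ] := atom_compr hM Tru e0.
by exists Z => X; apply/(ssub_atomsP hM) => a ha _; apply/hZ.
Qed.

Lemma complP (e : nat -> M) j k : sat e (f_compl (tvar j) (tvar k)) <->
  forall a : M, sAt a -> ssub a (e j) <-> ~ ssub a (e k).
Proof.
rewrite satE /=; set Y := e j; set X := e k.
split=> [[h1 h2] a ha|h]; last split=> W [hX hY].
- split=> [aY aX|nX]; first by apply: (atom_not_bot ha); rewrite (h1 a) //; apply: bot_sub.
  (* The covering clause of [f_compl] speaks of common upper bounds; applied to the join, it puts
     every element, [a] included, below it. *)
  have [Z hZ] := join_atoms Y X.
  have : ssub a Z by apply: h2; split; apply/(ssub_atomsP hM) => b hb ?; apply/hZ; tauto.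
  by move=> /(hZ a ha)[].
- apply/ssub_bot/(ssub_atomsP hM) => a ha aW.
  by case/(h a ha): (ssub_trans aW hY); apply: ssub_trans hX.
- move=> V; apply/(ssub_atomsP hM) => a ha _; have [aX|nX] := pselect (ssub a X).
    exact: ssub_trans hX.
  by apply: ssub_trans hY; apply/h.
Qed.

Lemma f_meetP (e : nat -> M) i j k : sat e (f_meet (tvar i) (tvar j) (tvar k)) <->
  forall a : M, sAt a -> ssub a (e i) <-> ssub a (e j) /\ ssub a (e k).
Proof.
rewrite satE /=; split=> [[h1 [h2 h3]] a ha|h].
  split=> [aZ|]; last exact: h3.
  by split; apply: ssub_trans aZ _.
split; [|split]; [by apply/(ssub_atomsP hM) => a ha /(h a ha)[]..|].
move=> W [/(ssub_atomsP hM) h1 /(ssub_atomsP hM) h2].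
by apply/(ssub_atomsP hM) => a ha aW; apply/h => //; split; [apply: h1|apply: h2].
Qed.

Lemma f_joinP (e : nat -> M) i j k : sat e (f_join (tvar i) (tvar j) (tvar k)) <->
  forall a : M, sAt a -> ssub a (e i) <-> ssub a (e j) \/ ssub a (e k).
Proof.
rewrite satE /=; set Z := e i; set X := e j; set Y := e k.
split=> [[h1 [h2 h3]] a ha|h].
  split=> [aZ|[]]; [|by move=> aX; apply: ssub_trans h1|by move=> aX; apply: ssub_trans h2].
  have [W hW] := join_atoms X Y.
  apply/hW => //; apply: ssub_trans aZ _; apply: h3.
  by split; apply/(ssub_atomsP hM) => b hb ?; apply/hW; tauto.
split; [|split]; [by apply/(ssub_atomsP hM) => a ha aX; apply/h; tauto..|].
move=> W [/(ssub_atomsP hM) h1 /(ssub_atomsP hM) h2].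
by apply/(ssub_atomsP hM) => a ha /(h a ha)[/h1|/h2]; apply.
Qed.

Lemma dwclP (e : nat -> M) k : sat e (f_dwcl (tvar k)) <->
  forall a : M, sAt a -> forall b : M, sAt b ->
    ssub a (e k) /\ slhd b a -> ssub b (e k).
Proof.
by rewrite satE /=.
Qed.

End SetAlgebra.

Local Notation base_axioms := (ba_axioms ++ order_axioms).

Lemma models_base (M : structure) : models M T_base <-> set_algebra M.
Proof.
split=> h.
  have ax i : i < 15 -> forall e : nat -> M, den e (nth stru base_axioms i).
    move=> hi e; rewrite -satE; apply: h; left; exact: mem_nth.
  have {}ax i hi := ax i hi (fun=> sbot M).
  have hrefl := ax 0 isT; have hanti := ax 1 isT; have htrans := ax 2 isT.
  have hbot := ax 3 isT; have hmeet := ax 5 isT.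
  have hjoin := ax 6 isT; have hdist := ax 7 isT; have hcompl := ax 8 isT.
  have hatom := ax 9 isT; have hat := ax 10 isT; have hirr := ax 11 isT.
  have hltr := ax 12 isT; have htot := ax 13 isT; have hlhd := ax 14 isT.
  move: hrefl hanti htrans hbot hmeet hjoin hdist hcompl hatom hat hirr hltr htot hlhd => /=.
  move=> hrefl hanti htrans hbot hmeet hjoin hdist hcompl hatom hat hirr hltr htot hlhd.
  have tr (X Y Z : M) : ssub X Y -> ssub Y Z -> ssub X Z by move=> *; apply: (htrans X Y).
  split=> //.
  - by move=> X Y ? ?; apply: hanti.
  - move=> X Y; split=> [XY a _ aX|hXY]; first exact: tr XY.
    (* Distributivity splits [X] into its parts [p] inside [Y] and [q] inside the complement. An
       atom of [q] would lie in [X], hence in [Y], so [q] is bottom and [X] is below [p]. *)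
    have [Y' [disj cov]] := hcompl Y.
    have [u hu] := hjoin Y Y'; have [v hv] := hmeet X u.
    have [p hp] := hmeet X Y; have [q hq] := hmeet X Y'; have [w hw] := hjoin p q.
    have vw : v = w by apply: (hdist X Y Y' u v p q w).
    have Xv : ssub X v.
      by apply: hv.2.2; split; [apply: hrefl|apply: cov; split; [apply: hu.1|apply: hu.2.1]].
    have [q0|[a [[na ha] aq]]] := hatom q.
      apply: (tr _ w); first by rewrite -vw.
      apply: (tr _ p); last exact: hp.2.1.
      by apply: hw.2.2; rewrite q0.
    case: (na); apply: disj; split; last by apply: tr aq _; apply: hq.2.1.
    by apply: hXY; [apply: (hat a).2|apply: tr aq _; apply: hq.1].
  - move=> A e; move: e; apply/holds_comp_form; have hA : bnd (bound A).+1 A.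
      exact: bnd_leq (leqnSn _) (bnd_bound A).
    apply: (h (comprehension hA)); right; by exists (bound A), A, hA.
move=> A [hA|[n [eta [hb ->]]]]; last first.
  by apply/holds_comp_form => e; apply: atom_compr.
have /(nthP stru)[i hi <-] := hA => e.
do 15?[case: i hi => [_|i hi]]; last by [].
- by rewrite satE /=; apply: ssub_refl.
- by rewrite satE /= => X Y [? ?]; apply: ssub_anti.
- by rewrite satE /= => X Y Z [XY YZ]; apply: (ssub_trans h XY YZ).
- by rewrite satE /=; apply: bot_sub.
- by rewrite satE /=; apply: top_atoms.
- move=> X Y; have [Z hZ] := meet_atoms h X Y; set e1 := scons _ _.
  change (sat e1 (Ex (f_meet (tvar 0) (tvar 2) (tvar 1)))); rewrite sat_ex.
  by exists Z; apply/f_meetP.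
- move=> X Y; have [Z hZ] := join_atoms h X Y; set e1 := scons _ _.
  change (sat e1 (Ex (f_join (tvar 0) (tvar 2) (tvar 1)))); rewrite sat_ex.
  by exists Z; apply/f_joinP.
- move=> X Y Z u v p q w; set e1 := scons _ _.
  pose F := f_join (tvar 4) (tvar 6) (tvar 5).
  pose F1 := And (f_meet (tvar 2) (tvar 7) (tvar 6)) (And
    (f_meet (tvar 1) (tvar 7) (tvar 5)) (f_join (tvar 0) (tvar 2) (tvar 1))).
  change (sat e1 (And F (And (f_meet (tvar 3) (tvar 7) (tvar 4)) F1)) -> v = w).
  rewrite (sat_and e1 F) (sat_and e1 (f_meet _ _ _) F1) (sat_and e1 (f_meet _ _ _)).
  rewrite (sat_and e1 (f_meet _ _ _) (f_join _ _ _)).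
  move=> [/(f_joinP h) hu [/(f_meetP h) hv [/(f_meetP h) hp]]].
  move=> [/(f_meetP h) hq /(f_joinP h) hw].
  apply: (atoms_eq h) => a ha; move: (hu a ha) (hv a ha) (hp a ha) (hq a ha) (hw a ha).
  tauto.
- move=> X; have [Z hZ] := compl_atoms h X; set e1 := scons _ _.
  change (sat e1 (Ex (f_compl (tvar 0) (tvar 1)))); rewrite sat_ex.
  by exists Z; apply/complP.
- rewrite satE /= => X; have [|/(ex_atom h)[a /(atomP h) ha aX]] := pselect (X = sbot M).
    by left.
  by right; exists a.
- by rewrite satE /= => X; apply: atomP.
- by rewrite satE /=; apply: lhd_irr.
- by rewrite satE /=; apply: lhd_trans.
- by rewrite satE /=; apply: lhd_total.
- by rewrite satE /=; apply: lhdP.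
Qed.

(** * Models of T_fin and their restrictions *)

(** In this form the axioms pass to restrictions at once, since an element below the bound keeps its
    atoms; successors, predecessors and endpoints would have to be found anew there. *)
Record fin_algebra (M : structure) : Prop := {
  fin_set_algebra : set_algebra M;
  ex_least : forall X : M, X <> sbot M -> exists a : M,
    [/\ sAt a, ssub a X & forall b : M, sAt b -> ssub b X -> ~ slhd b a];
  ex_greatest : forall X : M, X <> sbot M -> exists a : M,
    [/\ sAt a, ssub a X & forall b : M, sAt b -> ssub b X -> ~ slhd a b] }.

Section FinAlgebra.
Variable M : structure.

Lemma ex_definable (hM : set_algebra M) (P : M -> Prop) (A : form) (e : nat -> M) (a : M) :
  (forall b : M, sAt b -> sat (scons b e) A <-> P b) -> sAt a -> P a ->
  exists X : M, X <> sbot M /\ forall b : M, sAt b -> ssub b X <-> P b.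
Proof.
move=> hA ha Pa; have [X hX] := atom_compr hM A e.
have XP b : sAt b -> ssub b X <-> P b by move=> hb; rewrite (hX b hb) hA.
by exists X; split=> //; apply: (atom_neq_bot hM ha); apply/XP.
Qed.

(* The greatest atom of [X] is the predecessor of the least strict upper bound
   of [X], or the last atom if there is no strict upper bound. *)
Lemma models_fin : models M T_fin <-> fin_algebra M.
Proof.
pose e0 : nat -> M := fun=> sbot M.
split=> [h|h].
  have hM : set_algebra M by apply/models_base => A hA; apply: h; left.
  have ax i : i < 5 -> den e0 (nth stru fin_axioms i).
    by move=> hi; rewrite -satE; apply: h; right; apply: mem_nth.
  have := ax 4 isT; have := ax 3 isT; have := ax 1 isT => /= hpred hlast hleast.
  have {}hleast X : X <> sbot M -> exists a : M,
      [/\ sAt a, ssub a X & forall b : M, sAt b -> ssub b X -> ~ slhd b a].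
    by move=> nX; have [//|[a [ha [aX al]]]] := hleast X; exists a.
  split=> // X nX; have [c hc cX] := ex_atom hM nX.
  have lt_or (a b : M) : sAt a -> sAt b -> ~ slhd a b -> b = a \/ slhd b a.
    by move=> ha hb nab; have [//|[->|?]] := lhd_total hM ha hb; [left|right].
  pose P (u : M) := forall b : M, sAt b -> ssub b X -> slhd b u.
  have [[u [hu Pu]]|nP] := pselect (exists u : M, sAt u /\ P u).
    (* Under the quantifier, index 0 is the atom of [X], index 1 the candidate bound and index 2 the
       parameter [X]. *)
    pose above := AllAt (Imp (SubF (tvar 0) (tvar 2)) (Lhd (tvar 0) (tvar 1))).
    have [|U [nU hU]] := @ex_definable hM P above (scons X e0) u _ hu Pu.
      by move=> b hb; rewrite satE.
    have [v [hv /(hU v hv) Pv vl]] := hleast U nU.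
    have [|p [hp [pv nb]]] := hpred v hv; first by exists c; split=> //; apply: Pv.
    have nPp : ~ P p by move=> /(hU p hp) /(vl p hp).
    (* As [v] is the least strict upper bound, its predecessor [p] is not one. An atom [d] of [X]
       not strictly below [p] must equal [p], or it would lie strictly between [p] and [v]. *)
    have [d [hd dX ndp]] : exists d : M, [/\ sAt d, ssub d X & ~ slhd d p].
      apply: contrapT => h'; apply: nPp => d hd dX; apply: contrapT => ndp.
      by apply: h'; exists d.
    have pX : ssub p X.
      have [->//|pd] := lt_or _ _ hd hp ndp.
      by case: nb; exists d; split=> //; split=> //; apply: Pv.
    exists p; split=> // b hb bX pb; apply: nb; exists b; split=> //; split=> //.
    exact: Pv.
  have [|l [hl ll]] := hlast; first by exists c; split.
  have nPl : ~ P l by move=> Pl; apply: nP; exists l.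
  have [d [hd dX ndl]] : exists d : M, [/\ sAt d, ssub d X & ~ slhd d l].
    apply: contrapT => h'; apply: nPl => d hd dX; apply: contrapT => ndl.
    by apply: h'; exists d.
  have dl : l = d by have [//|/(ll _ hd)] := lt_or _ _ hd hl ndl.
  by exists l; split; rewrite ?dl // -dl => b hb _; apply: ll.
have hM := fin_set_algebra h.
move=> A [|hA]; first exact: (models_base M).2 hM A.
have [T hT] := top_atoms hM.
have /(nthP stru)[i hi <-] := hA => e.
do 5?[case: i hi => [_|i hi]]; last by []; rewrite satE /=.
- move=> a ha [b [hb ab]].
  have [|U [nU hU]] := @ex_definable hM (fun c => slhd a c)
    (Lhd (tvar 1) (tvar 0)) (scons a e0) b _ hb ab.
    by [].
  have [c [hc /(hU c hc) ac cl]] := ex_least h nU.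
  exists c; split=> //; split=> // -[d [hd [ad dc]]].
  by apply: (cl d) => //; apply/hU.
- move=> a ha [b [hb ba]].
  have [|U [nU hU]] := @ex_definable hM (fun c => slhd c a)
    (Lhd (tvar 0) (tvar 1)) (scons a e0) b _ hb ba.
    by [].
  have [c [hc /(hU c hc) ca cl]] := ex_greatest h nU.
  exists c; split=> //; split=> // -[d [hd [cd da]]].
  by apply: (cl d) => //; apply/hU.
- move=> [a [ha _]]; have [|b [hb _ bl]] := ex_least h (X := T).
    exact: (atom_neq_bot hM ha).
  by exists b; split=> // c hc; apply: bl.
- move=> [a [ha _]]; have [|b [hb _ bl]] := ex_greatest h (X := T).
    exact: (atom_neq_bot hM ha).
  by exists b; split=> // c hc; apply: bl.
- move=> X; have [->|nX] := pselect (X = sbot M); [by left|right].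
  by have [a [ha aX al]] := ex_least h nX; exists a.
Qed.

End FinAlgebra.

(** Comprehension in a restriction involves parameters, whereas [sat_relat] speaks of sentences. The
    condition [n <= k] keeps the variable that stands for [X] apart from the free variables of
    [A]. *)
Lemma sat_relat_open (M : structure) (X : M) (h : ssub (sbot M) X) A k n
    (f : nat -> M) (g : nat -> restrict h) : f k = X -> n <= k ->
  (forall i, i < n -> f i = sval (g i)) -> bnd n A ->
  sat f (relat k A) <-> sat g A.
Proof.
have tE m (f' : nat -> M) (g' : nat -> restrict h) t :
    (forall i, i < m -> f' i = sval (g' i)) -> tbnd m t ->
    teval f' t = sval (teval g' t) by move=> hfg; case: t => //= i /hfg.
elim: A k n f g => [|t u|t u|t|t u|B IHB C IHC|B IHB] k n f g fk nk hfg //=.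
- move=> /andP[/(tE _ _ _ _ hfg)-> /(tE _ _ _ _ hfg)->].
  by split=> [/eq_sig_hprop|->] //; apply=> *; apply: Prop_irrelevance.
- by move=> /andP[/(tE _ _ _ _ hfg)-> /(tE _ _ _ _ hfg)->].
- by move=> /(tE _ _ _ _ hfg)->.
- by move=> /andP[/(tE _ _ _ _ hfg)-> /(tE _ _ _ _ hfg)->].
- by move=> /andP[/(IHB _ _ _ _ fk nk hfg)-> /(IHC _ _ _ _ fk nk hfg)->].
- move=> hB; rewrite fk.
  have E a ha : sat (scons a f) (relat k.+1 B) <->
      sat (scons (exist _ a ha : restrict h) g) B.
    by apply: (IHB k.+1 n.+1) => // -[|i] //= /hfg.
  by split=> [H [a ha]|H a ha]; [apply/E/H|apply/(E a ha)].
Qed.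

Section Restrict.
Variables (M : structure) (X0 : M) (h0 : ssub (sbot M) X0).
Local Notation N := (restrict h0).

Lemma restrict_inj (a b : N) : sval a = sval b -> a = b.
Proof. by move=> ab; apply: eq_sig_hprop => // *; apply: Prop_irrelevance. Qed.

Lemma restrict_set_algebra : set_algebra M -> set_algebra N.
Proof.
move=> hM; split.
- by move=> X Y XY YX; apply/restrict_inj/(ssub_anti hM).
- move=> [X hX] [Y hY]; split=> [/= XY [a ha] /= _ aX|h].
    exact: (ssub_trans hM aX XY).
  apply/(ssub_atomsP hM) => a ha aX.
  exact: (h (exist _ a (ssub_trans hM aX hX))).
- by move=> X; apply: (bot_sub hM).
- move=> [a aX]; split=> /=.
    move=> /(atomP hM)[na ha]; split=> [/(congr1 sval)//|[b bX] /= /ha[]E].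
      by left; apply: restrict_inj.
    by right; apply: restrict_inj.
  move=> [na ha]; apply/(atomP hM); split=> [E|b ba].
    by apply: na; apply: restrict_inj.
  by have [] := ha (exist _ b (ssub_trans hM ba aX)) ba => /(congr1 sval); [left|right].
(* [f] carries the parameters below index [n] and [X0] from [n] on. Adding the atom moves [X0] to
   index [n.+1], out of reach of [A]; the first conjunct forces the defined set below [X0]. *)
- move=> A g; pose n := bound A; pose f i := if i < n then sval (g i) else X0.
  have [X hX] := atom_compr hM (And (SubF (tvar 0) (tvar n.+1)) (relat n.+1 A)) f.
  have fn : f n = X0 by rewrite /f ltnn.
  have XX0 : ssub X X0.
    by apply/(ssub_atomsP hM) => a ha /(hX a ha); rewrite sat_and /= fn => -[].
  exists (exist _ X XX0) => -[a aX] /= ha; rewrite (hX a ha) sat_and /= fn.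
  rewrite (@sat_relat_open M X0 h0 A n.+1 n.+1 _ (scons (exist _ a aX : N) g)) //; last first.
  - exact: bnd_leq (bnd_bound A).
  - by move=> [|i] //=; rewrite ltnS /f => ->.
  by split=> [[]|].
- by move=> [a ?]; apply: (lhd_irr hM).
- by move=> [a ?] ha [b ?] hb [c ?] hc; apply: (lhd_trans hM).
- move=> [a ?] ha [b ?] hb /=; have [|[E|]] := lhd_total hM ha hb; [by left| |by right; right].
  by right; left; apply: restrict_inj.
- move=> [X hX] [Y hY]; rewrite /= (lhdP hM).
  split=> [[a [ha [b [hb [aX [bY ab]]]]]]|[[a ?] [ha [[b ?] [hb [aX [bY ab]]]]]]].
    exists (exist _ a (ssub_trans hM aX hX)); split=> //.
    by exists (exist _ b (ssub_trans hM bY hY)).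
  by exists a; split=> //; exists b.
Qed.

Lemma restrict_fin_algebra : fin_algebra M -> fin_algebra N.
Proof.
move=> h; have hM := fin_set_algebra h; split; first exact: restrict_set_algebra.
all: move=> [X hX] nX; have nX' : X <> sbot M by move=> E; apply/nX/restrict_inj.
- have [a [ha aX al]] := ex_least h nX'; exists (exist _ a (ssub_trans hM aX hX)).
  by split=> // -[b ?]; apply: al.
- have [a [ha aX al]] := ex_greatest h nX'; exists (exist _ a (ssub_trans hM aX hX)).
  by split=> // -[b ?]; apply: al.
Qed.

End Restrict.

(** * Sums of structures *)

Lemma holds_closed (M : structure) (A : sentence) (e : nat -> M) : holds M A <-> sat e A.
Proof.
by split=> [|h f]; [apply|apply/(eq_sat (n := 0) (e2 := e)) => //; apply: sformP].
Qed.

(** The clause on equality makes [R] the graph of an isomorphism. As a relation it can be described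
    by traces on atoms, with no function to construct in either direction. *)
Lemma sat_rel (M N : structure) (R : M -> N -> Prop) A (e : nat -> M) (f : nat -> N) :
  (forall a, exists b, R a b) -> (forall b, exists a, R a b) -> R (sbot M) (sbot N) ->
  (forall a b, R a b -> sAt a <-> sAt b) ->
  (forall a b a' b', R a b -> R a' b' -> [/\ a = a' <-> b = b', ssub a a' <-> ssub b b' &
     slhd a a' <-> slhd b b']) ->
  (forall i, R (e i) (f i)) -> sat e A <-> sat f A.
Proof.
move=> totl totr R0 Rat Rbin.
have Rt (d : nat -> M) (g : nat -> N) t : (forall i, R (d i) (g i)) ->
  R (teval d t) (teval g t) by case: t => /=.
elim: A e f => [|t u|t u|t|t u|B IHB C IHC|B IHB] e f ef //=.
1,2,4: by have [] := Rbin _ _ _ _ (Rt _ _ t ef) (Rt _ _ u ef).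
- exact: Rat (Rt _ _ t ef).
- by rewrite (IHB e f) // (IHC e f).
- have E a b : R a b -> sat (scons a e) B <-> sat (scons b f) B.
    by move=> ab; apply: IHB => -[|i]; [exact: ab|exact: ef].
  split=> h; [move=> b; have [a ab] := totr b|move=> a; have [b ab] := totl a];
    exact/(E _ _ ab)/h.
Qed.

(** * Feferman-Vaught normal forms *)

Section ProductFormulas.

(* A list of pairs (F1, F2) stands for the disjunction over its members of
   "F1 holds in the first summand and F2 in the second". *)
Fixpoint dsat (M N : structure) (e : nat -> M) (f : nat -> N) (l : seq (form * form)) : Prop :=
  if l is p :: l' then (sat e p.1 /\ sat f p.2) \/ dsat e f l' else False.

(** A disjunction of pairs fails when each pair fails in one of its coordinates; expanding all
    choices of coordinate gives a disjunction of pairs again. *)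
Fixpoint dneg (l : seq (form * form)) : seq (form * form) :=
  if l is p :: l' then
    [seq (And (Neg p.1) q.1, q.2) | q <- dneg l'] ++
    [seq (q.1, And (Neg p.2) q.2) | q <- dneg l']
  else [:: (Tru, Tru)].

Definition dex (l : seq (form * form)) := [seq (Ex p.1, Ex p.2) | p <- l].

Definition dbnd n (l : seq (form * form)) := all (fun p => bnd n p.1 && bnd n p.2) l.

Lemma dbnd_neg n l : dbnd n l -> dbnd n (dneg l).
Proof.
elim: l => //= p l IH /andP[/andP[p1 p2] /IH {}IH].
rewrite /dbnd all_cat !all_map; apply/andP.
by split; apply: sub_all IH => q /= /andP[-> ->]; rewrite ?p1 ?p2.
Qed.

Lemma dbnd_ex n l : dbnd n.+1 l -> dbnd n (dex l).
Proof.
by rewrite /dbnd all_map; apply: sub_all => q /= /andP[-> ->].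
Qed.

Section Sat.
Local Arguments sat : simpl never.
Variables M N : structure.
Implicit Types (e : nat -> M) (f : nat -> N).

Lemma dsat_cat e f l1 l2 : dsat e f (l1 ++ l2) <-> dsat e f l1 \/ dsat e f l2.
Proof. by elim: l1 => /= [|p l1 ->]; tauto. Qed.

Lemma dsat_neg e f l : dsat e f (dneg l) <-> ~ dsat e f l.
Proof.
elim: l => /= [|p l IH]; first by tauto.
have El l' : dsat e f [seq (And (Neg p.1) q.1, q.2) | q <- l'] <->
    ~ sat e p.1 /\ dsat e f l'.
  by elim: l' => /= [|q l' ->]; [tauto|rewrite sat_and -[sat e (Neg _)]/(~ sat e _); tauto].
have Er l' : dsat e f [seq (q.1, And (Neg p.2) q.2) | q <- l'] <->
    ~ sat f p.2 /\ dsat e f l'.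
  by elim: l' => /= [|q l' ->]; [tauto|rewrite sat_and -[sat f (Neg _)]/(~ sat f _); tauto].
by rewrite dsat_cat El Er IH; have [] := pselect (sat e p.1); tauto.
Qed.

Lemma dsat_ex e f l :
  dsat e f (dex l) <-> exists a b, dsat (scons a e) (scons b f) l.
Proof.
elim: l => [|p l IH]; first by split=> // -[? [? []]].
rewrite /= !sat_ex IH.
split=> [[[[a ha] [b hb]]|[a [b h]]]|[a [b [[ha hb]|h]]]].
- by exists a, b; left.
- by exists a, b; right.
- by left; split; [exists a|exists b].
- by right; exists a, b.
Qed.

End Sat.

Definition pair_env (M N : structure) (e : nat -> M) (f : nat -> N) (i : nat) :
  oplus_str M N := (e i, f i).

Lemma teval_pair (M N : structure) (e : nat -> M) (f : nat -> N) t :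
  teval (pair_env e f) t = (teval e t, teval f t).
Proof. by case: t. Qed.

(** A pair with two coordinates different from bottom lies strictly above [(a, sbot N)], which is
    not bottom, so an atom lives in one coordinate only. *)
Lemma oplus_atom (M N : structure) : set_algebra M -> set_algebra N ->
  forall (a : M) (b : N), @sAt (oplus_str M N) (a, b) <->
    (sAt a /\ b = sbot N) \/ (a = sbot M /\ sAt b).
Proof.
move=> hM hN a b; split=> [[nab hab]|[[/(atomP hM)[na ha] ->]|[-> /(atomP hN)[nb hb]]]].
- have [a0|na] := pselect (a = sbot M); [right|left]; split=> //.
    apply/(atomP hN); split=> [b0|c cb]; first by apply: nab; rewrite a0 b0.
    by have [/(congr1 snd)|/(congr1 snd)] := hab (a, c) (conj (ssub_refl hM a) cb); [left|right].
  apply/(atomP hM); split=> // c ca.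
    by have [/(congr1 fst)|/(congr1 fst)] := hab (c, b) (conj ca (ssub_refl hN b)); [left|right].
  by have [/(congr1 fst)|/(congr1 snd)] := hab (a, sbot N) (conj (ssub_refl hM a) (bot_sub hN b)).
- split=> [[]//|[c d] [/= /ha ca /(ssub_bot hN) ->]].
  by case: ca => ->; [left|right].
- split=> [[]//|[c d] [/= /(ssub_bot hM) -> /hb ca]].
  by case: ca => ->; [left|right].
Qed.

(* Feferman and Vaught: truth in a sum is a disjunction of conjunctions of
   truths in the summands; [Ex] commutes with it as the domain is a product. *)
Lemma oplus_sat n A : bnd n A -> exists l, dbnd n l /\
  forall M N : structure, set_algebra M -> set_algebra N ->
  forall (e : nat -> M) (f : nat -> N), sat (pair_env e f) A <-> dsat e f l.
Proof.
elim: A n => [|t u|t u|t|t u|B IHB C IHC|B IHB] n /=.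
- by exists [::].
- move=> hb; exists [:: (EqF t u, EqF t u)]; rewrite /= hb; split=> // M N _ _ e f.
  by rewrite !teval_pair; split=> [[]|[[-> ->]|]] //; left.
- move=> hb; exists [:: (SubF t u, SubF t u)]; rewrite /= hb; split=> // M N _ _ e f.
  by rewrite !teval_pair /=; tauto.
- move=> hb; exists [:: (At t, EqF t tbot); (EqF t tbot, At t)].
  rewrite /= hb !andbT; split=> // M N hM hN e f; rewrite teval_pair.
  by have /= := oplus_atom hM hN (teval e t) (teval f t); tauto.
- move=> /andP[ht hu].
  exists [:: (Neg (EqF t tbot), Neg (EqF u tbot)); (Lhd t u, Tru); (Tru, Lhd t u)].
  rewrite /= ht hu; split=> // M N _ _ e f.
  by rewrite !teval_pair /=; tauto.
- move=> /andP[/IHB[l1 [b1 h1]] /IHC[l2 [b2 h2]]]; exists (dneg l1 ++ l2).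
  split=> [|M N hM hN e f]; first by rewrite /dbnd all_cat [all _ _]dbnd_neg.
  rewrite dsat_cat dsat_neg -(h1 M N) // -(h2 M N) //.
  by have [] := pselect (sat (pair_env e f) B); tauto.
- move=> /IHB[l [b1 h1]]; exists (dneg (dex (dneg l))).
  split=> [|M N hM hN e f]; first exact/dbnd_neg/dbnd_ex/dbnd_neg.
  have pE a b : scons ((a, b) : oplus_str M N) (pair_env e f) =
      pair_env (scons a e) (scons b f) by apply/funext => -[].
  rewrite dsat_neg dsat_ex; split=> [h [a [b /dsat_neg]]|h [a b]].
    by apply; rewrite -(h1 M N) // -pE; apply: h.
  rewrite pE (h1 M N) //; apply: contrapT => /dsat_neg h'.
  by apply: h; exists a, b.
Qed.

End ProductFormulas.

Lemma S0_bounded (x : S0) A : (sform @` cth x) A -> bnd 0 A.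
Proof. by move=> [B _ <-]; apply: sformP. Qed.

Lemma S0_model (x : S0) : exists M : structure, models M x.
Proof.
have [M [e h]] := model_existence (@S0_bounded x) (@S0_consistent x).
by exists M => A xA; apply/(holds_closed _ e)/h; exists A.
Qed.

Lemma S0_holds (x : S0) (M : structure) (A : sentence) :
  models M x -> x A <-> holds M A.
Proof.
move=> Mx; split=> [/Mx//|hA]; have [//|/Mx hn] := S0_complete x A.
by case: (hn (fun=> sbot M)); apply: hA.
Qed.

Lemma S0_fin_algebra (x : S0) (M : structure) : models M x -> fin_algebra M.
Proof. by move=> Mx; apply/models_fin => A hA; apply/Mx/S0_ext. Qed.

Lemma S0_set_algebra (x : S0) (M : structure) : models M x -> set_algebra M.
Proof. by move=> /S0_fin_algebra/fin_set_algebra. Qed.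

(** The list given by [oplus_sat] depends on [A] alone and consists of closed formulas, whose truth
    in the summands is decided by [x] and [y]. *)
Lemma oplus_wd (x y : S0) (M N M' N' : structure) (A : sentence) :
  models M x -> models N y -> models M' x -> models N' y ->
  holds (oplus_str M N) A -> holds (oplus_str M' N') A.
Proof.
move=> Mx Ny Mx' Ny'; have [l [+ h]] := oplus_sat (sformP A).
pose bot (M : structure) : nat -> M := fun=> sbot M.
rewrite (holds_closed _ (pair_env (bot M) (bot N))).
rewrite (holds_closed _ (pair_env (bot M') (bot N'))).
rewrite !h; try by apply: S0_set_algebra; eauto.
elim: l {h} => //= p l IH /andP[/andP[b1 b2] /IH {}IH].
move=> [[h1 h2]|/IH]; [left|by right].
have tr (u : S0) (K K' : structure) (B : form) : closed_form B -> models K u ->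
    models K' u -> sat (bot K) B -> sat (bot K') B.
  move=> hB Ku Ku'; have := S0_holds (Sentence hB) Ku.
  rewrite (S0_holds (Sentence hB) Ku') (holds_closed _ (bot K)).
  by rewrite (holds_closed _ (bot K')) => /= ->.
by split; [apply: tr Mx Mx' h1|apply: tr Ny Ny' h2].
Qed.

(** This is [sumform] without its outer quantifier: with X free, compactness can give it one value
    for all pairs of sentences. *)
Definition sum_body (A B : form) : form :=
  And (f_dwcl (tvar 0)) (And (relat 0 A)
    (Ex (And (f_compl (tvar 0) (tvar 1)) (relat 0 B)))).

Lemma sat_sum_body (M : structure) (bot_sub : forall X : M, ssub (sbot M) X)
    (e : nat -> M) (A B : sentence) :
  sat e (sum_body A B) <-> [/\ sat e (f_dwcl (tvar 0)),
    holds (restrict (bot_sub (e 0))) A &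
    exists2 Y : M, sat (scons Y e) (f_compl (tvar 0) (tvar 1)) &
      holds (restrict (bot_sub Y)) B].
Proof.
rewrite /sum_body !sat_and sat_ex (sat_relat (bot_sub (e 0)) A) //.
split=> [[h1 [h2 [Y]]]|[h1 h2 [Y h3 h4]]].
  by rewrite sat_and (sat_relat (bot_sub Y)) // => -[h3 h4]; split=> //; exists Y.
by do 2!split=> //; exists Y; rewrite sat_and (sat_relat (bot_sub Y)).
Qed.

Lemma holds_splus (M : structure) (A B : sentence) (e : nat -> M) :
  holds M (splus A B) <-> exists X : M, sat (scons X e) (sum_body A B).
Proof. by rewrite (holds_closed _ e) -sat_ex. Qed.

Lemma oplus_splus (M N : structure) (A B : sentence) : set_algebra M -> set_algebra N ->
  holds M A -> holds N B -> holds (oplus_str M N) (splus A B).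
Proof.
move=> hM hN MA NB; have [T1 hT1] := top_atoms hM; have [T2 hT2] := top_atoms hN.
have bs (X : oplus_str M N) : ssub (sbot (oplus_str M N)) X.
  by split; apply: bot_sub.
have not_lhd_bot (a : N) : ~ slhd a (sbot N).
  by rewrite (lhdP hN) => -[c [_ [d [hd [_ [/(atom_not_bot hN hd)]]]]]].
have not_bot_lhd (a : M) : ~ slhd (sbot M) a.
  by rewrite (lhdP hM) => -[c [hc [d [_ [/(atom_not_bot hM hc)]]]]].
apply/(holds_splus _ _ (fun=> sbot (oplus_str M N))).
exists (T1, sbot N); apply/(sat_sum_body bs); split.
- apply/dwclP => /= -[a a'] ha [b b'] hb [[_ /= /(ssub_bot hN) a'0]]; subst a'.
  move=> [[_ []//]|[/= ba|/not_lhd_bot//]]; split; [exact: hT1|rewrite /=].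
  have /(oplus_atom hM hN)[[_ ->]|[b0 _]] := hb; first exact: bot_sub.
  by case: (not_bot_lhd a); rewrite -b0.
(* Below [(T1, sbot N)] the second coordinate is bottom, so the first projection is an isomorphism
   onto [M]; the clauses of the sum order that involve [N] never apply, as nothing precedes
   bottom. *)
- pose R (p : restrict (bs (T1, sbot N))) (m : M) := (sval p).1 = m.
  apply/(holds_closed _ (fun=> sbot _)).
  apply/(@sat_rel _ _ R _ _ (fun=> sbot M)); last exact: MA.
  + by move=> p; exists (sval p).1.
  + move=> m; have hm : @ssub (oplus_str M N) (m, sbot N) (T1, sbot N).
      by split; [apply: hT1|apply: ssub_refl].
    by exists (exist (fun p => @ssub (oplus_str M N) p (T1, sbot N)) (m, sbot N) hm).
  + by [].
  + move=> [[a a'] h] b <-; have /= a'0 := ssub_bot hN h.2; subst a'.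
    change (@sAt (oplus_str M N) (a, sbot N) <-> sAt a).
    rewrite (oplus_atom hM hN); split=> [[[]//|[_ /(atomP hN)[]//]]|]; by left.
  + move=> [[a a'] h] b [[c c'] h'] d <- <-.
    have /= a'0 := ssub_bot hN h.2; have /= c'0 := ssub_bot hN h'.2.
    subst a' c'; split=> /=; split=> //.
    * by move=> [].
    * by move=> ac; apply: eq_exist; rewrite ac.
    * by case.
    * by split=> //; apply: ssub_refl.
    * by move=> [[_ []//]|[//|/not_lhd_bot//]].
    * by right; left.
  + by [].
- exists (sbot M, T2).
    rewrite satE /=; split=> [[a b] [/= [_ /(ssub_bot hN) ->] [/(ssub_bot hM) -> _]] //|].
    by move=> [a b] [[h1 _] [_ h2]] [c d]; split; [apply: ssub_trans h1|apply: ssub_trans h2].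
  pose R (p : restrict (bs (sbot M, T2))) (m : N) := (sval p).2 = m.
  apply/(holds_closed _ (fun=> sbot _)).
  apply/(@sat_rel _ _ R _ _ (fun=> sbot N)); last exact: NB.
  + by move=> p; exists (sval p).2.
  + move=> m; have hm : @ssub (oplus_str M N) (sbot M, m) (sbot M, T2).
      by split; [apply: ssub_refl|apply: hT2].
    by exists (exist (fun p => @ssub (oplus_str M N) p (sbot M, T2)) (sbot M, m) hm).
  + by [].
  + move=> [[a' a] h] b <-; have /= a'0 := ssub_bot hM h.1; subst a'.
    change (@sAt (oplus_str M N) (sbot M, a) <-> sAt a).
    rewrite (oplus_atom hM hN); split=> [[[/(atomP hM)[]//]|[_ //]]|]; by right.
  + move=> [[a' a] h] b [[c' c] h'] d <- <-.
    have /= a'0 := ssub_bot hM h.1; have /= c'0 := ssub_bot hM h'.1.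
    subst a' c'; split=> /=; split=> //.
    * by move=> [].
    * by move=> ac; apply: eq_exist; rewrite ac.
    * by case.
    * by split=> //; apply: ssub_refl.
    * by move=> [[[]//]|[/not_bot_lhd//|//]].
    * by right; right.
  + by [].
Qed.

(** * The extended Stone dual *)

(** Downward closure of [X] and totality put every atom of [X] before every atom of [Y], which is
    exactly the first clause of the order on a sum. Since [R] is stated on atoms, most of the
    comparison is propositional reasoning about one atom. *)
Lemma restrict_oplus (K : structure) (hK : set_algebra K) (X Y : K) (A : sentence) :
  (forall a : K, sAt a -> ssub a Y <-> ~ ssub a X) ->
  (forall a : K, sAt a -> forall b : K, sAt b -> ssub a X /\ slhd b a -> ssub b X) ->
  holds K A <->
  holds (oplus_str (restrict (bot_sub hK X)) (restrict (bot_sub hK Y))) A.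
Proof.
move=> YX dwX; set M := restrict (bot_sub hK X); set N := restrict (bot_sub hK Y).
have hM : set_algebra M by apply: restrict_set_algebra.
have hN : set_algebra N by apply: restrict_set_algebra.
have XorY a : sAt a -> ssub a X \/ ssub a Y.
  by move=> /YX ->; have [] := pselect (ssub a X); [left|right].
pose R (Z : K) (p : oplus_str M N) := forall a : K, sAt a ->
  (ssub a (sval p.1) <-> ssub a Z /\ ssub a X) /\
  (ssub a (sval p.2) <-> ssub a Z /\ ssub a Y).
have RP Z P Q : R Z (P, Q) -> ssub (sval P) Z /\ ssub (sval Q) Z.
  by move=> h; split; apply/(ssub_atomsP hK) => a ha aP;
    have /= [[hP _] [hQ _]] := h a ha; [case: (hP aP)|case: (hQ aP)].
rewrite (holds_closed _ (fun=> sbot K)) (holds_closed _ (fun=> sbot (oplus_str M N))).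
apply: (@sat_rel _ _ R).
- move=> Z; have [P hP] := meet_atoms hK Z X; have [Q hQ] := meet_atoms hK Z Y.
  have PX : ssub P X by apply/(ssub_atomsP hK) => a ha /(hP a ha)[].
  have QY : ssub Q Y by apply/(ssub_atomsP hK) => a ha /(hQ a ha)[].
  exists (exist _ P PX, exist _ Q QY) => a ha /=.
  by split; [apply: hP|apply: hQ].
- move=> [[P PX] [Q QY]]; have [Z hZ] := join_atoms hK P Q; exists Z => a ha /=.
  have [PX' QY'] : (ssub a P -> ssub a X) /\ (ssub a Q -> ssub a Y).
    by split=> h; [apply: ssub_trans PX|apply: ssub_trans QY].
  by move: (YX a ha) (hZ a ha); tauto.
- move=> a ha /=; have := atom_not_bot hK ha; tauto.
- move=> Z [[P PX] [Q QY]] ZPQ.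
  have [PZ QZ] := RP _ _ _ ZPQ; rewrite (oplus_atom hM hN).
  split=> [hZ|[[/= hP Q0]|[P0 /= hQ]]].
  + have E W : sAt W -> ssub W Z -> W = Z by move=> hW; apply: (atom_sub_atom hK).
    have [/= [hP1 hP2] [hQ1 hQ2]] := ZPQ Z hZ; have ZZ := ssub_refl hK Z.
    have [ZX|ZY] := XorY Z hZ; [left|right].
      have PE : P = Z by apply: (ssub_anti hK) => //; apply: hP2.
      split; first by rewrite /= PE.
      apply: eq_exist; apply: (atoms_eq hK) => a ha /=.
      split=> [aQ|/(atom_not_bot hK ha)//].
      have aZ := E a ha (ssub_trans hK aQ QZ); suff ZY : ssub Z Y by case: ((YX Z hZ).1 ZY ZX).
      by rewrite -aZ; apply: (ssub_trans hK aQ QY).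
    have QE : Q = Z by apply: (ssub_anti hK) => //; apply: hQ2.
    split; last by rewrite /= QE.
    apply: eq_exist; apply: (atoms_eq hK) => a ha /=.
    split=> [aP|/(atom_not_bot hK ha)//].
    have aZ := E a ha (ssub_trans hK aP PZ); suff ZX : ssub Z X by case: ((YX Z hZ).1 ZY ZX).
    by rewrite -aZ; apply: (ssub_trans hK aP PX).
  + have {}Q0 : Q = sbot K by case: Q0.
    suff -> : Z = P by []. apply: (atoms_eq hK) => a ha.
    have /= [hP' hQ'] := ZPQ a ha; have := XorY a ha; have := atom_not_bot hK ha.
    by move: hQ'; rewrite Q0; tauto.
  + have {}P0 : P = sbot K by case: P0.
    suff -> : Z = Q by []. apply: (atoms_eq hK) => a ha.
    have /= [hP' hQ'] := ZPQ a ha; have := XorY a ha; have := atom_not_bot hK ha.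
    by move: hP'; rewrite P0; tauto.
- move=> Z [[P PX] [Q QY]] Z' [[P' PX'] [Q' QY']] hZ hZ'.
  have [PZ QZ] := RP _ _ _ hZ; have [PZ' QZ'] := RP _ _ _ hZ'.
  have subE : ssub Z Z' <-> ssub P P' /\ ssub Q Q'.
    split=> [ZZ'|[/(ssub_atomsP hK) PP /(ssub_atomsP hK) QQ]].
      split; apply/(ssub_atomsP hK) => a ha h.
        have /= := hZ' a ha; have /= := hZ a ha.
        by have := ssub_trans hK (Y := Z) (X := a) (Z := Z'); tauto.
      have /= := hZ' a ha; have /= := hZ a ha.
      by have := ssub_trans hK (Y := Z) (X := a) (Z := Z'); tauto.
    apply/(ssub_atomsP hK) => a ha; have /= := hZ' a ha; have /= := hZ a ha.
    by have := XorY a ha; have := PP a ha; have := QQ a ha; tauto.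
  split.
  + split=> [E|[PP QQ]].
      subst Z'; congr pair; apply: eq_exist; apply: (atoms_eq hK) => a ha /=;
        by have /= := hZ' a ha; have /= := hZ a ha; tauto.
    subst P' Q'; apply: (atoms_eq hK) => a ha; have := XorY a ha.
    by have /= := hZ' a ha; have /= := hZ a ha; tauto.
  + exact: subE.
  + rewrite /= (lhdP hK Z) (lhdP hK P) (lhdP hK Q).
    split=> [[a [ha [b [hb [aZ [bZ' ab]]]]]]|[[/= nP nQ]|[]]].
    * have /= hZa := hZ a ha; have /= hZb := hZ' b hb.
      (* Two atoms on the same side are compared within that summand, and [a] in [X] with [b] in [Y]
         falls under the first clause; the remaining case contradicts downward closure. *)
      have [aX|aY] := XorY a ha; have [bX|bY] := XorY b hb.
      - right; left; exists a; split=> //; exists b; split=> //; tauto.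
      - left; split=> [[E]|[E]].
          by apply: (atom_not_bot hK ha); rewrite -E; tauto.
        by apply: (atom_not_bot hK hb); rewrite -E; tauto.
      - by case: ((YX a ha).1 aY); apply: (dwX b hb a ha).
      - right; right; exists a; split=> //; exists b; split=> //; tauto.
    (* Conversely, any atom of the left trace precedes any atom of the right one, by totality and
       downward closure. *)
    * have [|a ha aP] := ex_atom hK (X := P).
        by move=> P0; apply: nP; apply: eq_exist.
      have [|b hb bQ] := ex_atom hK (X := Q').
        by move=> Q0; apply: nQ; apply: eq_exist.
      have aX := ssub_trans hK aP PX; have bY := ssub_trans hK bQ QY'.
      exists a; split=> //; exists b; split=> //.
      split; first exact: (ssub_trans hK aP PZ).
      split; first exact: (ssub_trans hK bQ QZ').
      have nbX := (YX b hb).1 bY.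
      have [//|[ab|ba]] := lhd_total hK ha hb; case: nbX; first by rewrite -ab.
      exact: (dwX a ha b hb).
    * move=> [a [ha [b [hb [aP [bP ab]]]]]]; exists a; split=> //; exists b; split=> //.
      by split; [apply: (ssub_trans hK aP PZ)|split=> //; apply: (ssub_trans hK bP PZ')].
    * move=> [a [ha [b [hb [aP [bP ab]]]]]]; exists a; split=> //; exists b; split=> //.
      by split; [apply: (ssub_trans hK aP QZ)|split=> //; apply: (ssub_trans hK bP QZ')].
- move=> _ a ha /=; have := atom_not_bot hK ha; tauto.
Qed.

Lemma sat_sum_body_and (M : structure) (e : nat -> M) (A A' B B' : sentence) :
  sat e (sum_body (sand A A') (sand B B')) ->
  sat e (sum_body A B) /\ sat e (sum_body A' B').
Proof.
have relE k (C C' : sentence) : relat k (sand C C') = And (relat k C) (relat k C') by [].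
rewrite /sum_body !relE !sat_and !sat_ex => -[h1 [[h2 h2'] [Y]]].
rewrite !sat_and => -[h3 [h4 h4']].
by do 3!split=> //; exists Y; rewrite !sat_and.
Qed.

(* By compactness a single set X works for all members of [x] and [y]. *)
Lemma sum_decomposition (x y z : S0) :
  (forall A B : sentence, x A -> y B -> z (splus A B)) ->
  exists M N : structure, [/\ models M x, models N y &
    forall A : sentence, z A -> holds (oplus_str M N) A].
Proof.
move=> hz.
pose G : set form := (sform @` cth z) `|`
  [set F | exists A B : sentence, [/\ x A, y B & F = sum_body A B]].
have Gbnd F : G F -> bnd 1 F.
  move=> [/S0_bounded|[A [B [_ _ ->]]]]; first exact: bnd_leq.
  by have := sum_closed A B; rewrite /closed_form /= !andbT.
have [|K [e he]] := model_existence Gbnd.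
  move=> /prv_finite[l hl hF]; have [K0 K0z] := S0_model z.
  pose e0 : nat -> K0 := fun=> sbot K0.
  (* [A] and [B] are conjunctions of the sentences whose sums occur in [l]; the members of [l] that
     come from [z] hold in [K0] whatever X is. *)
  have [A [B [xA yB hAB]]] : exists A B : sentence, [/\ x A, y B &
      forall (X : K0), sat (scons X e0) (sum_body A B) ->
        forall F, F \in l -> sat (scons X e0) F].
    elim: l hl {hF} => [|F l IH] hl.
      by exists stru, stru; split=> //; apply: S0_tru.
    have [C Cl|A [B [xA yB hAB]]] := IH; first by apply: hl; rewrite inE Cl orbT.
    have [[C zC CF]|[A' [B' [xA' yB' FE]]]] := hl F (mem_head _ _).
      exists A, B; split=> // X hX C'; rewrite inE => /orP[/eqP->|]; last exact: hAB.
      by rewrite -CF; apply: K0z.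
    exists (sand A' A), (sand B' B); split; try exact: S0_and.
    move=> X /sat_sum_body_and[h1 h2] C; rewrite inE => /orP[/eqP->|]; last exact: hAB.
    by rewrite FE.
  have /(holds_splus _ _ e0)[X hX] := K0z _ (hz _ _ xA yB).
  exact: (soundness hF (hAB X hX)).
have Kz : models K z by move=> A zA; apply/(holds_closed _ e)/he; left; exists A.
have hK := S0_set_algebra Kz.
have body A B : x A -> y B -> sat e (sum_body A B).
  by move=> xA yB; apply: he; right; exists A, B.
(* The trivial instance names Y and gives downward closure; the complement in any other instance has
   the same atoms. *)
have /(sat_sum_body (bot_sub hK))[/dwclP dwX _ [Y /(complP hK) hY _]] :=
  body _ _ (S0_tru x) (S0_tru y).
exists (restrict (bot_sub hK (e 0))), (restrict (bot_sub hK Y)); split.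
- by move=> A xA; have /(sat_sum_body (bot_sub hK))[] := body _ _ xA (S0_tru y).
- move=> B yB.
  have /(sat_sum_body (bot_sub hK))[_ _ [Y' /(complP hK) hY' hB]] := body _ _ (S0_tru x) yB.
  suff -> : Y = Y' by []. apply: (atoms_eq hK) => a ha.
  by rewrite (hY a ha) (hY' a ha).
- by move=> A /Kz; rewrite (restrict_oplus hK _ hY dwX).
Qed.

(** Compactness yields only that [z] is contained in [oplus x y]. For the reverse inclusion,
    [oplus_wd] moves a sentence to the decomposition at hand, and completeness of [z] excludes its
    negation. *)
Lemma splus_oplus (x y z : S0) :
  (forall A B : sentence, x A -> y B -> z (splus A B)) <-> cth z = oplus x y.
Proof.
split=> [hz|-> A B xA yB]; last first.
  have [M Mx] := S0_model x; have [N Ny] := S0_model y; exists M, N; split=> //.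
  by apply: oplus_splus (Mx _ xA) (Ny _ yB); apply: S0_set_algebra; eauto.
have [M [N [Mx Ny hMN]]] := sum_decomposition hz.
apply/funext => A; apply/propext; split=> [zA|[M' [N' [Mx' Ny' hA]]]].
  by exists M, N; split=> //; apply: hMN.
have [//|/hMN hn] := S0_complete z A.
have {}hA := oplus_wd Mx' Ny' Mx Ny hA.
by case: (hn (fun=> sbot _)); apply: hA.
Qed.

(** * Passage to classes of sentences and to ultrafilters *)

Lemma entails_holds (M : structure) (A B : sentence) : fin_algebra M ->
  entails A B -> holds M A -> holds M B.
Proof.
move=> hM AB hA e; apply: (soundness AB (e := e) _ (hA e)) => _ [C TC <-].
by move/models_fin: hM => /(_ C TC); apply.
Qed.

(** Exchanges the representatives chosen by [LT_plus] for given sentences; in a model of [z], the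
    same X and Y witness both sums. *)
Lemma splus_mono (z : S0) (A A' B B' : sentence) : entails A A' -> entails B B' ->
  z (splus A B) -> z (splus A' B').
Proof.
move=> AA BB zAB; have [K Kz] := S0_model z.
have hK := S0_fin_algebra Kz; have hK' := fin_set_algebra hK.
have /(holds_splus _ _ (fun=> sbot K))[X] := Kz _ zAB.
move=> /(sat_sum_body (bot_sub hK'))[h1 h2 [Y h3 h4]].
apply/(S0_holds _ Kz)/(holds_splus _ _ (fun=> sbot K)).
exists X; apply/(sat_sum_body (bot_sub hK')); split=> //.
  by apply: entails_holds AA h2; apply: restrict_fin_algebra.
by exists Y => //; apply: entails_holds BB h4; apply: restrict_fin_algebra.
Qed.

Lemma uf_of_cls (x : S0) (A : sentence) : uf_of x (cls A) <-> x A.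
Proof. exact: ufE. Qed.

Lemma uf_of_trel (x y z : S0) :
  trel (r := ext_stone_dual LT_plus) (uf_of x) (uf_of y) (uf_of z) <->
  forall A B : sentence, x A -> y B -> z (splus A B).
Proof.
split=> [h A B xA yB|h _ [a xa [b yb <-]]].
  have [[A1 _] [B1 _]] := (repr_cls A, repr_cls B).
  apply: (splus_mono A1 B1); apply/uf_of_cls; apply: h.
  by exists (cls A); [apply/uf_of_cls|exists (cls B) => //; apply/uf_of_cls].
by apply/uf_of_cls/h; apply/uf_of_cls; rewrite cls_repr.
Qed.

Lemma S0_inj (x y : S0) : cth x = cth y -> x = y.
Proof.
case: x y => [T h1 h2 h3] [T' h1' h2' h3'] /= E; subst T'.
by congr MkS0; apply: Prop_irrelevance.
Qed.

Section OfUltrafilter.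
Variable u : ultrafilter LT.

Let T : theory := [set A | u (cls A)].

Lemma uf_entails A B : entails A B -> u (cls A) -> u (cls B).
Proof. by move=> AB; apply: uf_up; apply/LT_le_cls. Qed.

Fact of_uf_ext : T_fin `<=` T.
Proof.
move=> A TA; apply: (@uf_entails stru); last exact: uf_top.
by apply/prv_impI/prv_wk/prv_ax; exists A.
Qed.

(** A refutation uses finitely many sentences; the meet of their classes is in [u] and would lie
    below bottom. *)
Fact of_uf_consistent : consistent T.
Proof.
move=> /prv_finite[l hl hF].
have [C uC hC] : exists2 C : sentence, u (cls C) &
    forall F, F \in l -> prv (sform C |` (sform @` T_fin)) F.
  elim: l hl {hF} => [|F l IH] hl; first by exists stru => //; apply: uf_top.
  have [D Dl|C uC hC] := IH; first by apply: hl; rewrite inE Dl orbT.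
  have [D uD DF] := hl F (mem_head _ _); exists (sand D C).
    by rewrite cls_and; apply: uf_meet.
  have /prv_andP[hD hC'] := prv_hyp (sform @` T_fin) (And D C).
  move=> E; rewrite inE => /orP[/eqP->|/hC hE]; first by rewrite -DF.
  by apply: prv_cuts hE => F' [->|GF] //; apply: prv_ax; right.
apply: (@uf_proper _ _ u); apply: (@uf_entails C sfal) => //.
exact/prv_impI/(prv_cuts hC hF).
Qed.

Fact of_uf_complete A : T A \/ T (sneg A).
Proof.
have [|h] := uf_ultra u (cls A); [by left|right; apply: uf_entails h].
(* The complement of [cls A] is the class of the negated representative, which still has to be
   carried to [sneg A]. *)
have [_ A2] := repr_cls A; apply/prv_impI/prv_impI.
apply: (prv_impE (prv_wk _ (prv_hyp _ _))).
by apply: (prv_impE (A := A)); [do 2!apply: prv_wk; exact: A2|apply: prv_hyp].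
Qed.

Definition of_uf : S0 := MkS0 of_uf_ext of_uf_consistent of_uf_complete.

Lemma of_ufK : uf_of of_uf = u.
Proof.
have E : uset (uf_of of_uf) = uset u.
  apply/funext => a; rewrite -(cls_repr a); apply/propext; exact: uf_of_cls.
move: (uf_of of_uf) E => v; case: v u => [U h1 h2 h3 h4 h5] [U' g1 g2 g3 g4 g5] /= E.
by subst U'; congr Ultrafilter; apply: Prop_irrelevance.
Qed.

End OfUltrafilter.

Lemma uf_ofK (x : S0) : of_uf (uf_of x) = x.
Proof. by apply/S0_inj/funext => A; apply/propext/uf_of_cls. Qed.

Theorem theorem5p13 :
  (forall x y z : S0,
     [set splus phi psi | phi in cth x & psi in cth y] `<=` cth z <->
     cth z = oplus x y) /\
  relspace_iso (X := S0_space) (Y := ext_stone_dual LT_plus) uf_of.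
Proof.
split=> [x y z|].
  rewrite -splus_oplus; split=> [h A B xA yB|h _ [A xA [B yB <-]]]; last exact: h.
  by apply: h; exists A => //; exists B.
split.
- by exists of_uf; [apply: uf_ofK|apply: of_ufK].
(* A point contains [A] exactly when its ultrafilter contains [cls A], so the basic open sets of the
   two spaces correspond. *)
- move=> U; change (uf_open U -> S0_open (uf_of @^-1` U)) => oU x /oU[a xa aU].
  exists (repr a); first by apply/uf_of_cls; rewrite cls_repr.
  by move=> y /uf_of_cls; rewrite cls_repr => /aU.
- move=> U; change (S0_open U -> uf_open (uf_of @` U)) => oU _ [x /oU[A xA AU] <-].
  exists (cls A); first exact/uf_of_cls.
  by move=> v vA; exists (of_uf v); [apply: AU|apply: of_ufK].
- by move=> x y z; rewrite uf_of_trel splus_oplus.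
Qed.
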